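(* The vertex snippet $\mathcal{H}_{A,A'}$ of the stochastic masking game $\mathcal{G}_{A,A'}$ is almost-sure failing under fairness if and only if $v_0^{\mathcal{SG}}\in V^{\mathcal{SG}}\setminus \exists\mathrm{Pre}^{*}\big(V^{\mathcal{SG}}\setminus\forall\mathrm{Pre}^{*}(\{v_{\text{err}}\})\big)$, where $v_0^{\mathcal{SG}}$ is the initial vertex and $V^{\mathcal{SG}}$ the set of vertices of the symbolic game graph $\mathcal{SG}_{A,A'}$.
   Context: Setting: PTSs (finite, every state has an outgoing transition) $A=(S,\Sigma,\rightarrow,s_0)$ (nominal) and $A'=(S',\Sigma\cup\mathcal{F},\rightarrow',s'_0)$ (implementation), $\mathcal{F}$ a finite set of fault labels disjoint from $\Sigma$. $\mathrm{Couplings}(\mu,\mu')$ denotes the polytope of couplings of $\mu,\mu'$ and $\mathrm{vertices}(\cdot)$ its extreme points. Stochastic masking game graph $\mathcal{G}_{A,A'}$ (Refuter vs. Verifier): Refuter vertices $(s,-,s',-,-,-,\mathsf{R})$ and $v_{\text{err}}$; Verifier vertices $(s,\sigma^1,s',\mu,-,-,\mathsf{V})$ ($\sigma\in\Sigma$, $s\xrightarrow{\sigma}\mu$) and $(s,\sigma^2,s',-,\mu',-,\mathsf{V})$ ($\sigma\in\Sigma\cup\mathcal{F}$, $s'\xrightarrow{\sigma}{}'\mu'$); probabilistic vertices $(s,-,s',\mu,\mu',w,\mathsf{P})$ with $w\in\mathrm{Couplings}(\mu,\mu')$. The Refuter picks a transition of either model; the Verifier answers with a same-labelled transition of the other model and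 a coupling $w$, except that after a fault $F\in\mathcal{F}$ of $A'$ she must use $\Delta_s$; from a probabilistic vertex the game moves to $(t,-,t',-,-,-,\mathsf{R})$ with probability $w(t,t')$; a Verifier vertex with no move goes to $v_{\text{err}}$, which loops. The vertex snippet $\mathcal{H}_{A,A'}$ is this graph restricted to probabilistic vertices with $w\in\mathrm{vertices}(\mathrm{Couplings}(\mu,\mu'))$. Fairness: a play is Refuter-fair if every Refuter vertex visited infinitely often has all its successors visited infinitely often; a Refuter strategy is fair if against every Verifier strategy it produces a fair play with probability 1; a game is almost-sure failing under fairness if for every Verifier strategy and every fair Refuter strategy, $v_{\text{err}}$ is reached with probability 1 from the initial vertex. The symbolic game graph $\mathcal{SG}_{A,A'}$ is $\mathcal{G}_{A,A'}$ with the coupling component removed (vertices $(s,-,s',-,-,\mathsf{R})$, $v_{\text{err}}$, $(s,\sigma^1,s',\mu,-,\mathsf{V})$, $(s,\sigma^2,s',-,\mu',\mathsf{V})$, $(s,-,s',\mu,\mu',\mathsf{P})$), where a probabilistic vertex has edges to all $(t,-,t',-,-,\mathsf{R})$ with $t\in\mathrm{Supp}(\mu)$, $t'\in\mathrm{Supp}(\mu')$; initial vertex $v_0^{\mathcal{SG}}=(s_0,-,s'_0,-,-,\mathsf{R})$; $\mathit{Post}(v)$ denotes successors in $\mathcal{SG}_{A,A'}$. For a probabilistic vertex $v=(s,-,s',\mu,\mu',\mathsf{P})$ and a set $C$ of vertices, $\mathit{Eq}(v,C)$ is the linear system in variables $x_{t,t'}$ ($t\in\mathrm{Supp}(\mu)$,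 $t'\in\mathrm{Supp}(\mu')$): $\sum_{t'}x_{t,t'}=\mu(t)$, $\sum_t x_{t,t'}=\mu'(t')$, $x_{t,t'}\ge0$, and $\sum_{(t,-,t',-,-,\mathsf{R})\in C}x_{t,t'}=0$. Predecessor operators on sets $C$ of symbolic vertices: $\exists\mathrm{Pre}(C)=\{v\in V^{\mathcal{SG}}\mid\mathit{Post}(v)\cap C\neq\emptyset\}$; $\forall\mathrm{Pre}(C)$ is the union of the Verifier vertices $v$ with $\mathit{Post}(v)\subseteq C$, the Refuter vertices $v$ with $\mathit{Post}(v)\cap C\neq\emptyset$, and the probabilistic vertices $v$ for which $\mathit{Eq}(v,C)$ has no solution. $\exists\mathrm{Pre}^{*}(C)$ and $\forall\mathrm{Pre}^{*}(C)$ denote the iterated closures (the least sets containing $C$ and closed under the respective operator). *)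

(* Defs.v *)
From HB Require Import structures.
From mathcomp Require Import all_boot all_order all_algebra.
From mathcomp Require Import all_classical all_reals all_analysis.

Set Implicit Arguments.
Unset Strict Implicit.
Unset Printing Implicit Defensive.

Import Order.TTheory GRing.Theory Num.Theory.

Local Open Scope classical_set_scope.
Local Open Scope ring_scope.

Section Distributions.
Variable R : realType.

Record dist (T : finType) := Dist {
  dist_val :> {ffun T -> R} ;
  _ : [forall x, 0 <= dist_val x] && (\sum_x dist_val x == 1) }.

HB.instance Definition _ (T : finType) := [isSub for @dist_val T].
HB.instance Definition _ (T : finType) := [Choice of dist T by <:].

Lemma dirac_dist_subproof (T : finType) (a : T) :
  let f : {ffun T -> R} := [ffun x => (x == a)%:R] in
  [forall x, 0 <= f x] && (\sum_x f x == 1).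
Proof.
apply/andP; split; first by apply/forallP => x; rewrite ffunE ler0n.
rewrite (bigD1 a) //= ffunE eqxx big1 ?addr0 // => x /negbTE xa.
by rewrite ffunE xa.
Qed.

Definition dirac_dist (T : finType) (a : T) : dist T :=
  Dist (dirac_dist_subproof a).

Definition supp (T : finType) (mu : dist T) : {set T} := [set x | mu x != 0]%SET.

Definition couplings (S S' : finType) (mu : dist S) (mu' : dist S') :
    set (dist (S * S')%type) :=
  [set w | (forall t, \sum_t' w (t, t') = mu t) /\
           (forall t', \sum_t w (t, t') = mu' t')].

Definition extreme_points (T : finType) (C : set (dist T)) : set (dist T) :=
  [set w | C w /\ forall (w1 w2 : dist T) (l : R),
     C w1 -> C w2 -> 0 < l < 1 ->
     (forall x, w x = l * w1 x + (1 - l) * w2 x) -> w1 = w /\ w2 = w].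

End Distributions.

Record pts (R : realType) (L : finType) := PTS {
  state : finType ;
  trans : state -> L -> dist R state -> Prop ;
  init : state ;
  trans_finite : finite_set [set x | trans x.1.1 x.1.2 x.2] ;
  trans_total : forall s, exists a mu, trans s a mu }.

Inductive owner := Refuter | Verifier | Probabilistic.

Record game (R : realType) (V : pointedType) := Game {
  vertex_set : set V ;
  owner_of : V -> owner ;
  edge : V -> V -> Prop ;
  delta : V -> V -> R ;
  initial : V }.

Section Games.
Variables (R : realType) (V : pointedType).

Definition subgame (G : game R V) (W : set V) : game R V :=
  Game (vertex_set G `&` W) (owner_of G)
       (fun u v => [/\ W u, W v & edge G u v]) (delta G) (initial G).

(* [pi h v u] is the probability of moving to [u] when the current vertex is
   [v] and the previously visited vertices are [h]. *)
Definition strategy := seq V -> V -> V -> R.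

(* The sum over [setT] is 0 when the summand has infinite support, so the last
   condition also makes [pi h v] finitely supported. *)
Definition is_strategy (G : game R V) (p : owner) (pi : strategy) : Prop :=
  forall h v, vertex_set G v -> owner_of G v = p ->
    [/\ forall u, 0 <= pi h v u,
        forall u, pi h v u != 0 -> edge G v u
      & \sum_(u \in [set: V]) pi h v u = 1].

Definition step (G : game R V) (piR piV : strategy) (h : seq V) (v u : V) : R :=
  match owner_of G v with
  | Refuter => piR h v u
  | Verifier => piV h v u
  | Probabilistic => delta G v u
  end.

Definition cylinders : set (set (nat -> V)) :=
  [set B | exists n v, B = [set rho | rho n = v]].

Definition plays := g_sigma_algebraType cylinders.

(* Characterizes the probability measure that the two strategies induce on
   infinite plays from the initial vertex: for genuine strategies, and [delta]
   a distribution at probabilistic vertices, there is exactly one such [P]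
   (Ionescu-Tulcea), so quantifying over [P] below is not vacuous. *)
Definition is_play_measure (G : game R V) (piR piV : strategy)
    (P : probability plays R) : Prop :=
  forall (r : nat -> V) (n : nat),
    P [set rho : plays | forall i, (i <= n)%N -> rho i = r i] =
    ((r 0 == initial G)%:R *
     \prod_(i < n) step G piR piV (mkseq r i) (r i) (r i.+1))%:E.

Definition visited_io (rho : nat -> V) (v : V) : Prop :=
  forall n, exists2 m, (n <= m)%N & rho m = v.

Definition refuter_fair_plays (G : game R V) : set plays :=
  [set rho | forall v, vertex_set G v -> owner_of G v = Refuter ->
     visited_io rho v -> forall u, edge G v u -> visited_io rho u].

Definition fair_refuter_strategy (G : game R V) (piR : strategy) : Prop :=
  is_strategy G Refuter piR /\
  forall piV, is_strategy G Verifier piV ->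
  forall P, is_play_measure G piR piV P -> P (refuter_fair_plays G) = 1%E.

Definition almost_sure_failing_under_fairness (G : game R V) (err : V) : Prop :=
  forall piV, is_strategy G Verifier piV ->
  forall piR, fair_refuter_strategy G piR ->
  forall P, is_play_measure G piR piV P ->
    P [set rho : plays | exists n, rho n = err] = 1%E.

End Games.

(* The label set of the implementation, the disjoint union of the nominal
   labels and the fault labels, is the sum type [Sigma + F]. *)

Section MaskingGame.
Variables (R : realType) (Sigma F : finType).
Variables (A : pts R Sigma) (A' : pts R (Sigma + F)%type).
Local Notation S := (state A).
Local Notation S' := (state A').
Local Notation D := (dist R S).
Local Notation D' := (dist R S').

Inductive gvertex :=
  | GR of S & S'
  | GErr
  | GV1 of S & Sigma & S' & D
  | GV2 of S & (Sigma + F)%type & S' & D'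
  | GP of S & S' & D & D' & dist R (S * S')%type.

HB.instance Definition _ := gen_eqMixin gvertex.
HB.instance Definition _ := gen_choiceMixin gvertex.
HB.instance Definition _ := isPointed.Build gvertex GErr.

(* The pairs of distributions that a probabilistic vertex over [(s, s')] may
   carry: two transitions with the same label, or [Delta_s] and a fault. *)
Definition matched (s : S) (s' : S') (mu : D) (mu' : D') : Prop :=
  (exists a, trans s a mu /\ trans s' (inl a) mu') \/
  (exists f, mu = dirac_dist R s /\ trans s' (inr f) mu').

Definition masking_vertices : set gvertex :=
  [set v | match v with
    | GR _ _ | GErr => True
    | GV1 s a s' mu => trans s a mu
    | GV2 s a s' mu' => trans s' a mu'
    | GP s s' mu mu' w => matched s s' mu mu' /\ couplings mu mu' w
    end].

Definition masking_owner (v : gvertex) : owner :=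
  match v with
  | GR _ _ | GErr => Refuter
  | GV1 _ _ _ _ | GV2 _ _ _ _ => Verifier
  | GP _ _ _ _ _ => Probabilistic
  end.

Inductive masking_move : gvertex -> gvertex -> Prop :=
  | MoveR1 s s' a mu : trans s a mu ->
      masking_move (GR s s') (GV1 s a s' mu)
  | MoveR2 s s' a mu' : trans s' a mu' ->
      masking_move (GR s s') (GV2 s a s' mu')
  | MoveV1 s s' a mu mu' w : trans s' (inl a) mu' -> couplings mu mu' w ->
      masking_move (GV1 s a s' mu) (GP s s' mu mu' w)
  | MoveV2 s s' a mu mu' w : trans s a mu -> couplings mu mu' w ->
      masking_move (GV2 s (inl a) s' mu') (GP s s' mu mu' w)
  | MoveVF s s' f mu' w : couplings (dirac_dist R s) mu' w ->
      masking_move (GV2 s (inr f) s' mu') (GP s s' (dirac_dist R s) mu' w)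
  | MoveP s s' mu mu' (w : dist R (S * S')%type) t t' : w (t, t') != 0 ->
      masking_move (GP s s' mu mu' w) (GR t t')
  | MoveErr : masking_move GErr GErr.

Definition masking_edge (u v : gvertex) : Prop :=
  masking_move u v \/
  [/\ masking_owner u = Verifier, ~ (exists x, masking_move u x) & v = GErr].

Definition masking_delta (u v : gvertex) : R :=
  match u, v with
  | GP _ _ _ _ w, GR t t' => w (t, t')
  | _, _ => 0
  end.

Definition masking_game : game R gvertex :=
  Game masking_vertices masking_owner masking_edge masking_delta
       (GR (init A) (init A')).

Definition vertex_snippet : game R gvertex :=
  subgame masking_game
    [set v | match v with
      | GP s s' mu mu' w => extreme_points (couplings mu mu') w
      | _ => True
      end].

Inductive svertex :=
  | SR of S & S'
  | SErr
  | SV1 of S & Sigma & S' & D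
  | SV2 of S & (Sigma + F)%type & S' & D'
  | SP of S & S' & D & D'.

Definition sg_vertices : set svertex :=
  [set v | match v with
    | SR _ _ | SErr => True
    | SV1 s a s' mu => trans s a mu
    | SV2 s a s' mu' => trans s' a mu'
    | SP s s' mu mu' => matched s s' mu mu'
    end].

Definition sg_owner (v : svertex) : owner :=
  match v with
  | SR _ _ | SErr => Refuter
  | SV1 _ _ _ _ | SV2 _ _ _ _ => Verifier
  | SP _ _ _ _ => Probabilistic
  end.

Inductive sg_move : svertex -> svertex -> Prop :=
  | SMoveR1 s s' a mu : trans s a mu -> sg_move (SR s s') (SV1 s a s' mu)
  | SMoveR2 s s' a mu' : trans s' a mu' -> sg_move (SR s s') (SV2 s a s' mu')
  | SMoveV1 s s' a mu mu' : trans s' (inl a) mu' ->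
      sg_move (SV1 s a s' mu) (SP s s' mu mu')
  | SMoveV2 s s' a mu mu' : trans s a mu ->
      sg_move (SV2 s (inl a) s' mu') (SP s s' mu mu')
  | SMoveVF s s' f mu' :
      sg_move (SV2 s (inr f) s' mu') (SP s s' (dirac_dist R s) mu')
  | SMoveP s s' mu mu' t t' : t \in supp mu -> t' \in supp mu' ->
      sg_move (SP s s' mu mu') (SR t t')
  | SMoveErr : sg_move SErr SErr.

Definition sg_edge (u v : svertex) : Prop :=
  sg_move u v \/
  [/\ sg_owner u = Verifier, ~ (exists x, sg_move u x) & v = SErr].

Definition sg_initial : svertex := SR (init A) (init A').

Definition Post (v : svertex) : set svertex := [set u | sg_edge v u].

Definition Eq_solution (mu : D) (mu' : D') (C : set svertex) (x : S -> S' -> R) :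
    Prop :=
  [/\ forall t, t \in supp mu -> \sum_(t' in supp mu') x t t' = mu t,
      forall t', t' \in supp mu' -> \sum_(t in supp mu) x t t' = mu' t',
      forall t t', t \in supp mu -> t' \in supp mu' -> 0 <= x t t'
    & \sum_(t in supp mu) \sum_(t' in supp mu' | `[< C (SR t t') >]) x t t' = 0].

Definition exPre (C : set svertex) : set svertex :=
  [set v | sg_vertices v /\ Post v `&` C !=set0].

Definition allPre (C : set svertex) : set svertex :=
  [set v | sg_vertices v /\
    match sg_owner v with
    | Verifier => Post v `<=` C
    | Refuter => Post v `&` C !=set0
    | Probabilistic =>
        exists s s' mu mu', v = SP s s' mu mu' /\
          ~ (exists x, Eq_solution mu mu' C x)
    end].

Definition least_closed (pre : set svertex -> set svertex) (C : set svertex) :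
    set svertex :=
  \bigcap_(X in [set X | C `<=` X /\ pre X `<=` X]) X.

Definition exPre_star := least_closed exPre.
Definition allPre_star := least_closed allPre.

End MaskingGame.

Arguments GErr {R Sigma F} A A'.
Arguments SErr {R Sigma F} A A'.
Arguments sg_vertices {R Sigma F} A A' _.

(* Main.v *)
Require Import Defs.
From HB Require Import structures.
From mathcomp Require Import all_boot all_order all_algebra.
From mathcomp Require Import finmap ring lra.
From mathcomp Require Import all_classical all_reals all_analysis.

(* If every symbolic vertex reachable from the initial one lies in the attractor
   [allPre_star], fix a play that is Refuter-fair and visits every successor of
   a probabilistic vertex visited infinitely often; almost every play is such.
   The vertices whose infinite recurrence forces a visit to the error vertex
   contain the error vertex and are closed under [allPre], hence contain the
   attractor, and some vertex of the finite snippet is visited infinitely often.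

   Conversely, a symbolic path that leaves the attractor lifts to the snippet:
   a coupling of minimal support among those with a prescribed positive entry is
   an extreme point. Both players follow the lifted path, which has positive
   probability; afterwards the Verifier stays outside the attractor, using
   extreme couplings supported there, and the Refuter plays round-robin, which
   is fair on every play. *)

Set Implicit Arguments.
Unset Strict Implicit.
Unset Printing Implicit Defensive.

Import Order.TTheory GRing.Theory Num.Theory.

Local Open Scope classical_set_scope.
Local Open Scope ring_scope.

(** * Extreme couplings *)

Section Distributions.
Variables (R : realType) (T : finType).
Implicit Types w : dist R T.

Lemma dist_ge0 w x : 0 <= w x.
Proof. by case: w => f /= /andP[/forallP]. Qed.

Lemma dist_sum1 w : \sum_x w x = 1.
Proof. by case: w => f /= /andP[_ /eqP]. Qed.

Lemma dist_gt0 w x : (0 < w x) = (w x != 0).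
Proof. by rewrite lt_def dist_ge0 andbT. Qed.

Lemma dist_le1 w x : w x <= 1.
Proof.
rewrite -(dist_sum1 w) (bigD1 x) //= lerDl.
by apply: sumr_ge0 => y _; exact: dist_ge0.
Qed.

Lemma dist_ext w1 w2 : (forall x, w1 x = w2 x) -> w1 = w2.
Proof. by move=> e; apply/val_inj/ffunP. Qed.

Lemma dist_of_fun (f : T -> R) :
  (forall x, 0 <= f x) -> \sum_x f x = 1 -> exists w, forall x, w x = f x.
Proof.
move=> f0 f1.
have P : [forall x, 0 <= [ffun x => f x] x] && (\sum_x [ffun x => f x] x == 1).
  apply/andP; split; first by apply/forallP => x; rewrite ffunE.
  by rewrite -f1; apply/eqP/eq_bigr => x _; rewrite ffunE.
by exists (Dist P) => x /=; rewrite ffunE.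
Qed.

Lemma dist_inhabited w : exists x, w x != 0.
Proof.
apply: contrapT => /forallNP h; have := dist_sum1 w.
rewrite big1 // => [/eqP|x _].
  by rewrite eq_sym oner_eq0.
by apply/eqP/negPn/negP/h.
Qed.

End Distributions.

Section Couplings.
Variables (R : realType) (S S' : finType) (mu : dist R S) (mu' : dist R S').
Implicit Types w : dist R (S * S')%type.

Lemma product_coupling :
  exists w, couplings mu mu' w /\ forall t t', w (t, t') = mu t * mu' t'.
Proof.
have [| |w hw] := @dist_of_fun R (S * S')%type (fun x => mu x.1 * mu' x.2).
- by move=> x; rewrite mulr_ge0 ?dist_ge0.
- rewrite -(pair_bigA _ (fun t t' => mu t * mu' t')) /= -(dist_sum1 mu).
  by apply: eq_bigr => t _; rewrite -mulr_sumr dist_sum1 mulr1.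
exists w; split=> [|t t']; last by rewrite hw.
split=> [t|t'].
  under eq_bigr do rewrite hw /=.
  by rewrite -mulr_sumr dist_sum1 mulr1.
under eq_bigr do rewrite hw /=.
by rewrite -mulr_suml dist_sum1 mul1r.
Qed.

Lemma coupling_supp w t t' : couplings mu mu' w -> w (t, t') != 0 ->
  (t \in supp mu) && (t' \in supp mu').
Proof.
move=> [m1 m2] wn0; rewrite !inE -m1 -m2 -!dist_gt0 in wn0 *.
apply/andP; split; apply: lt0r_neq0.
  rewrite (bigD1 t') //= ltr_wpDr // sumr_ge0 // => i _; exact: dist_ge0.
rewrite (bigD1 t) //= ltr_wpDr // sumr_ge0 // => i _; exact: dist_ge0.
Qed.

(** The difference [w2 - w3] has zero marginals, so only nonnegativity limits how far [w1] can move
    along it. *)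
Lemma affine_coupling (a : R) w1 w2 w3 : couplings mu mu' w1 ->
  couplings mu mu' w2 -> couplings mu mu' w3 ->
  (forall x, 0 <= w1 x + a * w2 x - a * w3 x) ->
  exists2 w, couplings mu mu' w & forall x, w x = w1 x + a * w2 x - a * w3 x.
Proof.
move=> [l1 r1] [l2 r2] [l3 r3] pos.
have [//||w hw] := @dist_of_fun R (S * S')%type
    (fun x => w1 x + a * w2 x - a * w3 x).
  by rewrite sumrB big_split /= -!mulr_sumr !dist_sum1 addrK.
exists w => //; split=> t.
  under eq_bigr do rewrite hw.
  by rewrite sumrB big_split /= -!mulr_sumr l1 l2 l3 addrK.
under eq_bigr do rewrite hw.
by rewrite sumrB big_split /= -!mulr_sumr r1 r2 r3 addrK.
Qed.

(* If a coupling is not extreme, it can be moved along a direction between two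
   other couplings until some entry vanishes; of the two opposite directions,
   one does not decrease the entry at [p]. *)
Lemma shrink_coupling w p : couplings mu mu' w -> w p != 0 ->
  ~ extreme_points (couplings mu mu') w ->
  exists w', [/\ couplings mu mu' w', w' p != 0 & supp w' \proper supp w].
Proof.
move=> cw wp next.
have [w1 [w2 [c1 c2 w12 sub dp]]] : exists w1 w2,
    [/\ couplings mu mu' w1, couplings mu mu' w2, w1 <> w2,
        forall x, w x = 0 -> w1 x = 0 /\ w2 x = 0 & w2 p <= w1 p].
  have [w1 [w2 [c1 c2 w12 sub]]] : exists w1 w2,
    [/\ couplings mu mu' w1, couplings mu mu' w2, w1 <> w2 &
        forall x, w x = 0 -> w1 x = 0 /\ w2 x = 0].
    apply: contrapT => H; apply: next; split=> // w1 w2 l c1 c2 /andP[l0 l1] e.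
    have [w12|w12] := pselect (w1 = w2).
      have -> : w = w1 by apply: dist_ext => x; rewrite e -w12 -mulrDl addrC subrK mul1r.
      by split.
    exfalso; apply: H; exists w1, w2; split=> // x wx0.
    have := e x; rewrite wx0 => /esym/eqP.
    rewrite paddr_eq0 ?mulr_ge0 ?dist_ge0 ?subr_ge0 1?ltW // !mulf_eq0.
    by rewrite subr_eq0 (gt_eqF l0) (gt_eqF l1) /= => /andP[/eqP ? /eqP ?].
  have [h|/ltW h] := leP (w2 p) (w1 p); first by exists w1, w2.
  exists w2, w1; split=> //; first exact/nesym.
  by move=> x /sub[].
(* Both have mass 1, so a nowhere negative [w1 - w2] would have sum 0 and vanish. *)
have [x0 dx0] : exists x, w1 x < w2 x.
  apply: contrapT => /forallNP h; apply: w12; apply: dist_ext => x.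
  apply/eqP; rewrite -subr_eq0; apply/eqP.
  have ge y : true -> 0 <= w1 y - w2 y by rewrite subr_ge0 leNgt => _; apply/negP/h.
  have s0 : \sum_y (w1 y - w2 y) = 0 by rewrite sumrB !dist_sum1 subrr.
  exact: (psumr_eq0P ge s0).
(* Ratio test: [c] is the largest step along [w1 - w2] that keeps all entries nonnegative, and the
   entry at the minimizer drops to 0. *)
case: (arg_minP (P := fun x => w1 x < w2 x) (fun x => w x / (w2 x - w1 x)) dx0).
move=> x dx xmin; set c := w x / (w2 x - w1 x) in xmin.
have c0 : 0 <= c by rewrite divr_ge0 ?dist_ge0 // subr_ge0 ltW.
have [y|w' cw' ew'] := @affine_coupling c w w1 w2 cw c1 c2.
  rewrite -addrA -mulrBr.
  have [dy|dy] := ltP (w1 y) (w2 y); last first.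
    by rewrite addr_ge0 ?dist_ge0 // mulr_ge0 // subr_ge0.
  rewrite -opprB mulrN subr_ge0 -ler_pdivlMr ?subr_gt0 //.
  exact: xmin.
exists w'; split=> //.
  rewrite -dist_gt0 ew' -addrA -mulrBr ltr_pwDl ?dist_gt0 //.
  by rewrite mulr_ge0 // subr_ge0.
apply/properP; split.
  apply/fintype.subsetP => y; rewrite !inE; apply: contra => /eqP wy0.
  by have [e1 e2] := sub _ wy0; rewrite ew' wy0 e1 e2 !mulr0 addr0 subr0.
exists x; rewrite !inE.
  apply: contraTN dx => /eqP /sub[-> ->]; by rewrite ltxx.
rewrite negbK ew' -addrA -mulrBr -[w1 x - _]opprB mulrN /c divfK ?subrr //.
by rewrite subr_eq0 gt_eqF.
Qed.

(** Repeated shrinking strictly reduces the support, so it ends at an extreme point with the entry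
    at [p] still positive. Positivity at [p] later lifts a prescribed edge; the inclusion of
    supports keeps the coupling outside the attractor. *)
Lemma extreme_coupling_below w p : couplings mu mu' w -> w p != 0 ->
  exists w', [/\ extreme_points (couplings mu mu') w', w' p != 0 &
    forall x, w x = 0 -> w' x = 0].
Proof.
have [n] := ubnP #|supp w|; elim: n w => // n IH w le cw wp.
have [ew|/(shrink_coupling cw wp)[w1 [c1 w1p pr]]] :=
  pselect (extreme_points (couplings mu mu') w); first by exists w.
have [|w' [ew' w'p sub]] := IH w1 _ c1 w1p.
  by rewrite (leq_trans (proper_card pr)).
exists w'; split=> // x wx0; apply: sub; apply/eqP/negPn/negP => nx.
by have/fintype.subsetP/(_ x) := proper_sub pr; rewrite !inE nx wx0 eqxx => /(_ isT).
Qed.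

Lemma extreme_coupling_exists : exists w, extreme_points (couplings mu mu') w.
Proof.
have [w [cw _]] := product_coupling.
have [p wp] := dist_inhabited w.
by have [w' [? _ _]] := extreme_coupling_below cw wp; exists w'.
Qed.

(** If the supports agree, a small multiple [m * w2] fits below [w1], so [w1] is a proper convex
    combination of [w2] and the normalized rest; extremality identifies them. *)
Lemma extreme_coupling_supp_inj w1 w2 :
  extreme_points (couplings mu mu') w1 -> couplings mu mu' w2 ->
  supp w2 = supp w1 -> w2 = w1.
Proof.
move=> [c1 ext] c2 e.
have [x0 x0P] := dist_inhabited w1.
case: (arg_minP (P := fun x => w1 x != 0) (fun x => w1 x) x0P) => x xP xmin.
(* Half the least positive entry of [w1]: then [m * w2 y <= m <= w1 y] on the common support, and
   the halving gives [m < 1]. *)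
set m := w1 x / 2.
have m0 : 0 < m by rewrite divr_gt0 // dist_gt0.
have m1 : m <= 1 / 2 by rewrite ler_pM2r // dist_le1.
have le y : m * w2 y <= w1 y.
  have [w1y|w1y] := eqVneq (w1 y) 0.
    have : y \notin supp w2 by rewrite e inE w1y eqxx.
    by rewrite inE negbK => /eqP ->; rewrite mulr0 w1y.
  apply: (@le_trans _ _ (w1 x)); last exact: xmin.
  rewrite -[leRHS]mulr1 ler_pM ?dist_le1 ?dist_ge0 // ?ltW //.
  by rewrite /m ltr_pdivrMr // ltr_pMr ?dist_gt0 // ltr1n.
clear e; have m1' : m < 1 by lra.
(* The rest [u] is [(w1 - m * w2) / (1 - m)], written as a displacement of [w1] along [w1 - w2]. *)
have [y|u cu eu] := @affine_coupling (m / (1 - m)) w1 w1 w2 c1 c1 c2.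
  have -> : w1 y + m / (1 - m) * w1 y - m / (1 - m) * w2 y
    = (w1 y - m * w2 y) / (1 - m) by field; lra.
  by rewrite divr_ge0 ?subr_ge0 // ltW.
have [|y|//] := ext w2 u m c2 cu; first by rewrite m0.
by rewrite eu; field; lra.
Qed.

Lemma finite_extreme_couplings : finite_set (extreme_points (couplings mu mu')).
Proof.
have [w0 _] := extreme_coupling_exists.
(* [w0] is a default for sets that are not the support of an extreme coupling. *)
pose g A := xget w0 [set w | extreme_points (couplings mu mu') w /\ supp w = A].
apply: (@sub_finite_set _ _ (g @` [set: {set S * S'}])).
  move=> w ew; exists (supp w) => //.
  have [] : [set w' | extreme_points (couplings mu mu') w' /\ supp w' = supp w]
      (g (supp w)) by apply: (@xgetPex _ w0 [set w' | _]); exists w.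
  by move=> [cg _] e; exact: extreme_coupling_supp_inj ew cg e.
exact/finite_image/finite_finset.
Qed.

End Couplings.

(** * Processes with a finite state space *)

Section Cylinders.
Variable V : pointedType.

(** The prefix is split into history and current vertex, the form in which strategies and kernels
    take their arguments. *)
Definition cyl (h : seq V) (x : V) : set (plays V) :=
  [set rho | mkseq rho (size h).+1 = rcons h x].

Lemma cyl_nil x : cyl [::] x = [set rho | rho 0%N = x].
Proof.
rewrite /cyl /mkseq; apply/seteqP; split => rho /=; first by case.
by move=> ->.
Qed.

Lemma cyl_rcons h x y :
  cyl (rcons h x) y = cyl h x `&` [set rho | rho (size h).+1 = y].
Proof.
rewrite /cyl size_rcons; apply/seteqP; split => rho /=;
  rewrite (mkseqS _ (size h).+1).
  by move=> /rcons_inj[-> ->].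
by move=> [-> ->].
Qed.

Lemma cyl_nth h x y : cyl h x = [set rho | forall i, (i <= size h)%N ->
  rho i = nth y (rcons h x) i].
Proof.
apply/seteqP; split => rho /=.
  by rewrite /cyl /= => <- i ile; rewrite nth_mkseq.
move=> e; rewrite /cyl /=; apply: (@eq_from_nth _ y).
  by rewrite size_mkseq size_rcons.
by move=> i; rewrite size_mkseq => ilt; rewrite nth_mkseq // e.
Qed.

Lemma cyl_mkseq rho n : cyl (mkseq rho n) (rho n) rho.
Proof. by rewrite /cyl /= size_mkseq mkseqS. Qed.

Lemma measurable_coord n (v : V) : measurable [set rho : plays V | rho n = v].
Proof. by apply: sub_sigma_algebra; exists n, v. Qed.

Lemma measurable_coord_neq n (v : V) :
  measurable [set rho : plays V | rho n <> v].
Proof. exact: (measurableC (measurable_coord n v)). Qed.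

Lemma measurable_cyl h x : measurable (cyl h x).
Proof.
elim/last_ind: h x => [|h z IH] x; first by rewrite cyl_nil; exact: measurable_coord.
by rewrite cyl_rcons; apply: measurableI => //; exact: measurable_coord.
Qed.

Lemma measurable_visited_io (v : V) :
  measurable [set rho : plays V | visited_io rho v].
Proof.
rewrite (_ : mkset _ = \bigcap_n \bigcup_(m in [set m | (n <= m)%N])
    [set rho : plays V | rho m = v]).
  apply: bigcapT_measurable => n; apply: bigcup_measurable => m _.
  exact: measurable_coord.
apply/seteqP; split => rho /=.
  by move=> io n _; have [m nm e] := io n; exists m.
by move=> io n; have [m nm e] := io n I; exists m.
Qed.

End Cylinders.

Section AlmostEverywhere.
Context d (T : measurableType d) (R : realType) (P : probability T R).

Lemma ae_forall_countType (I : countType) (Q : I -> T -> Prop) :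
  (forall i, \forall x \ae P, Q i x) -> \forall x \ae P, forall i, Q i x.
Proof.
move=> Qae.
have H : \forall x \ae P, forall n : nat,
    if @choice.unpickle I n is Some i then Q i x else True.
  apply: ae_foralln => n; case: (choice.unpickle n) => [i|]; first exact: Qae.
  exact: aeW.
have aeF := ae_filter_ringOfSetsType P.
by apply: filterS H => x + i => /(_ (choice.pickle i)); rewrite choice.pickleK.
Qed.

Lemma ae_prob1 (E : set T) : measurable E -> (\forall x \ae P, E x) <-> P E = 1%E.
Proof.
move=> mE; have PE := probability_setC P mE.
split=> [aeE|e].
  have PC : P (~` E) = 0%E by apply/negligibleP => //; exact: measurableC.
  by rewrite -[E]setCK (probability_setC P (measurableC mE)) PC sube0.
apply/negligibleP; first exact: measurableC.
by have := PE; rewrite e subee.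
Qed.

End AlmostEverywhere.

Section Process.
Variables (R : realType) (V : pointedType) (X : {fset V}) (x0 : V).
Variable K : seq V -> V -> V -> R.
Hypothesis x0X : x0 \in X.
Hypothesis K_ge0 : forall h x y, x \in X -> 0 <= K h x y.
Hypothesis K_sum : forall h x, x \in X -> \sum_(y <- X) K h x y = 1.
Variable P : probability (plays V) R.
Hypothesis PK : forall r n,
  P [set rho : plays V | forall i, (i <= n)%N -> rho i = r i] =
  ((r 0%N == x0)%:R * \prod_(i < n) K (mkseq r i) (r i) (r i.+1))%:E.

Let mcyl := @measurable_cyl V.
#[local] Hint Extern 0 (measurable (cyl _ _)) => exact: mcyl : core.

Lemma prob_cyl_nil x : P (cyl [::] x) = ((x == x0)%:R)%:E.
Proof.
rewrite (cyl_nth _ _ point) (PK (nth point [:: x]) 0) /= big_ord0 mulr1 //.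
Qed.

Lemma prob_cyl_rcons h x y :
  P (cyl (rcons h x) y) = (P (cyl h x) * (K h x y)%:E)%E.
Proof.
pose r := nth y (rcons (rcons h x) y).
have er i : (i <= size h)%N -> nth y (rcons h x) i = r i.
  by move=> ile; rewrite /r [RHS]nth_rcons size_rcons ltnS ile.
have -> : cyl h x = [set rho | forall i, (i <= size h)%N -> rho i = r i].
  rewrite (cyl_nth _ _ y); apply/seteqP; split => rho /= e i ile.
    by rewrite e // er.
  by rewrite e // er.
rewrite (cyl_nth _ _ y) (PK r) (PK r) size_rcons -EFinM big_ord_recr /= mulrA.
have -> : mkseq r (size h) = h.
  rewrite -[RHS](mkseq_nth y); apply/eq_in_map => i; rewrite mem_iota /= add0n => ilt.
  by rewrite -(er _ (ltnW ilt)) nth_rcons ilt.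
have -> : r (size h) = x by rewrite -er // nth_rcons ltnn eqxx.
by have -> : r (size h).+1 = y by rewrite /r nth_rcons size_rcons ltnn eqxx.
Qed.

Lemma fin_num_cyl h x : P (cyl h x) \is a fin_num.
Proof. exact: fin_num_measure. Qed.

(** The illegal continuations of one prefix. Discarding these null sets for the countably many
    prefixes over [X] makes almost every play obey [K]. *)
Definition bad_step h x : set (plays V) :=
  cyl h x `\` \bigcup_(y in [set` [seq y <- X | K h x y != 0]]) cyl (rcons h x) y.

Lemma trivIset_cyl h x (D : set V) : trivIset D (cyl (rcons h x)).
Proof.
move=> y z _ _ [rho []]; rewrite !cyl_rcons => -[_ /= <-] [_ /= <-] //.
Qed.

(** The successors of nonzero weight have total weight 1, so their disjoint cylinders exhaust the
    measure of [cyl h x]. *)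
Lemma prob_bad_step h x : x \in X -> P (bad_step h x) = 0%E.
Proof.
move=> xX; set D := [seq y <- X | K h x y != 0].
have fD : finite_set [set` D] by exact: finite_seq.
have mU : measurable (\bigcup_(y in [set` D]) cyl (rcons h x) y).
  exact: fin_bigcup_measurable.
rewrite /bad_step -/D measureD //; last first.
  by rewrite ltey_eq fin_num_cyl.
rewrite setIidr; last by move=> rho [y _]; rewrite cyl_rcons => -[].
rewrite measure_fin_bigcup //; last exact: trivIset_cyl.
rewrite -fsbig_seq ?filter_uniq ?fset_uniq // big_filter.
rewrite (eq_bigr (fun y => P (cyl h x) * (K h x y)%:E)%E); last first.
  by move=> y _; exact: prob_cyl_rcons.
rewrite -ge0_sume_distrr; last by move=> y _; rewrite lee_fin K_ge0.
rewrite sumEFin.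
have -> : \sum_(y <- X | K h x y != 0) K h x y = 1.
  rewrite -(K_sum h xX) big_mkcond; apply: eq_bigr => y _.
  by case: eqP => // ->.
by rewrite mule1 subee // fin_num_cyl.
Qed.

Lemma measurable_bad_step h x : measurable (bad_step h x).
Proof. by apply: measurableD => //; exact: fin_bigcup_measurable. Qed.

(** Total probability over the next vertex: only plays of the null set [bad_step h x] escape the
    decomposition. *)
Lemma prob_cyl_split h x (E : set (plays V)) : x \in X -> measurable E ->
  P (cyl h x `&` E) = (\sum_(y <- X) P (cyl (rcons h x) y `&` E))%E.
Proof.
move=> xX mE.
have mU : measurable (\bigcup_(y in [set` X]) (cyl (rcons h x) y `&` E)).
  by apply: fin_bigcup_measurable => // y _; exact: measurableI.
have mB : measurable (bad_step h x `&` E).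
  by apply: measurableI => //; exact: measurable_bad_step.
have -> : P (cyl h x `&` E) =
    P ((\bigcup_(y in [set` X]) (cyl (rcons h x) y `&` E)) `|` (bad_step h x `&` E)).
  congr (P _); apply/seteqP; split => rho /=.
    move=> [hx Er]; have [|nb] := pselect (bad_step h x rho); first by right.
    left; apply: contrapT => nU; apply: nb; split=> // -[y /=].
    by rewrite mem_filter => /andP[_ yX] hy; apply: nU; exists y.
  move=> [[y _ []]|[[]]] //; rewrite cyl_rcons => -[]//.
rewrite measureU0 //; last first.
  apply: (subset_measure0 (B := bad_step h x)) => //; last exact: prob_bad_step.
  exact: measurable_bad_step.
rewrite measure_fin_bigcup //.
- by rewrite -fsbig_seq ?fset_uniq.
- exact/trivIset_setIr/trivIset_cyl.
- by move=> y _; exact: measurableI.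
Qed.

Lemma ae_initial : \forall rho \ae P, rho 0%N = x0.
Proof.
rewrite /almost_everywhere /=.
apply/negligibleP; first exact: measurable_coord_neq.
change (P (~` [set rho : plays V | rho 0%N = x0]) = 0%E).
rewrite probability_setC; last exact: measurable_coord.
by rewrite -cyl_nil prob_cyl_nil eqxx subee.
Qed.

Lemma ae_steps : \forall rho \ae P, rho 0%N = x0 /\
  forall n, rho n \in X /\ K (mkseq rho n) (rho n) (rho n.+1) != 0.
Proof.
(* Histories over the finite type [X] are countable, whereas [V] may be uncountable; so countably
   many null sets suffice. *)
pose nb (i : seq X * X) (rho : plays V) := ~ bad_step (map val i.1) (val i.2) rho.
have nbae i : \forall rho \ae P, nb i rho.
  exists (bad_step (map val i.1) (val i.2)); split.
  - exact: measurable_bad_step.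
  - exact/prob_bad_step/valP.
  - by move=> rho /= /contrapT.
have aeok := ae_forall_countType nbae.
have [aeF ae0] := (ae_filter_ringOfSetsType P, ae_initial).
apply: filterS2 ae0 aeok => rho r0 ok; split=> //.
(* Inductively, a play outside the null sets never leaves [X], so each of its prefixes is one of the
   indices. *)
have allX n : exists s : seq X, mkseq rho n = map val s /\ rho n \in X.
  elim: n => [|n [s [es rnX]]]; first by exists [::]; rewrite r0.
  exists (rcons s [` rnX]%fset); split; first by rewrite mkseqS es map_rcons.
  have := ok (s, [` rnX]%fset); rewrite /nb /= -es => nbad.
  apply: contrapT => nX; apply: nbad; split; first exact: cyl_mkseq.
  move=> [y /=]; rewrite mem_filter => /andP[_ yX]; rewrite cyl_rcons size_mkseq.
  by move=> [_ /= e]; apply: nX; rewrite e.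
move=> n; have [s [es rnX]] := allX n; split=> //.
have := ok (s, [` rnX]%fset); rewrite /nb /= -es => nbad.
apply/negP => /eqP K0; apply: nbad; split; first exact: cyl_mkseq.
move=> [y /=]; rewrite mem_filter => /andP[Ky _]; rewrite cyl_rcons size_mkseq.
by move=> [_ /= e]; move: Ky; rewrite -e K0 eqxx.
Qed.

(** * Recurrence along steps of uniformly positive probability *)

Section Transfer.
Variables (v u : V) (p : R).
Hypotheses (vX : v \in X) (uX : u \in X) (p_gt0 : 0 < p).
Hypothesis K_ge : forall h, p <= K h v u.

Lemma transfer_le1 : p <= 1.
Proof.
rewrite -(K_sum [::] vX) (big_rem u uX) /=; apply: (le_trans (K_ge [::])).
by rewrite lerDl sumr_ge0 // => y _; exact: K_ge0.
Qed.

(* From time [m] on and within [n] steps, [v] is visited [k] times and none of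
   these visits is followed by [u]. *)
Fixpoint misses n k m : set (plays V) :=
  match k, n with
  | 0, _ => setT
  | _.+1, 0 => set0
  | k'.+1, n'.+1 =>
      [set rho | rho m = v] `&` [set rho | rho m.+1 <> u] `&` misses n' k' m.+1 `|`
      [set rho | rho m <> v] `&` misses n' k m.+1
  end.

Lemma measurable_misses n k m : measurable (misses n k m).
Proof.
elim: n k m => [|n IH] [|k] m //=.
apply: measurableU; repeat apply: measurableI => //.
- exact: measurable_coord.
- exact: measurable_coord_neq.
- exact: measurable_coord_neq.
Qed.

(** Whatever the past, a visit of [v] avoids the successor [u] with probability at most [1 - p], so
    [k] such visits cost a factor [(1 - p) ^+ k]. The horizon [n] carries the induction. *)
Lemma prob_misses_cyl n k h x : x \in X ->
  (P (cyl h x `&` misses n k (size h)) <= P (cyl h x) * ((1 - p) ^+ k)%:E)%E.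
Proof.
have q0 : 0 <= 1 - p by rewrite subr_ge0 transfer_le1.
elim: n k h x => [|n IH] [|k] h x xX.
- by rewrite setIT expr0 mule1.
- by rewrite setI0 measure0 mule_ge0 // lee_fin exprn_ge0.
- by rewrite setIT expr0 mule1.
set E := misses n.+1 k.+1 (size h).
have mE : measurable E by exact: measurable_misses.
rewrite prob_cyl_split //.
(* At [v] the cylinder of [u] contributes nothing and the other weights sum to at most [1 - p];
   elsewhere the inductive bounds are merely averaged. *)
have [xv|xv] := eqVneq x v.
  apply: (@le_trans _ _ (\sum_(y <- X) P (cyl h x) *
      ((if y == u then 0 else K h x y) * (1 - p) ^+ k)%:E)%E).
    rewrite big_seq [leRHS]big_seq; apply: lee_sum => y yX.
    have [->|yu] := eqVneq y u.
      rewrite mul0r mule0 (_ : _ `&` _ = set0) ?measure0 //.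
      rewrite -subset0 => rho [] + [[[_ +] _]|[+ _]]; rewrite !cyl_rcons.
        by move=> [_ /= ->].
      by move=> [+ _]; rewrite /cyl /= mkseqS xv => /rcons_inj[].
    rewrite EFinM muleA -prob_cyl_rcons; apply: le_trans (IH k _ _ yX).
    apply: le_measure; rewrite ?inE.
    - exact: measurableI.
    - by apply: measurableI => //; exact: measurable_misses.
    rewrite size_rcons => rho [] + [[_]|[+ _]] //; rewrite cyl_rcons.
    by move=> [+ _]; rewrite /cyl /= mkseqS xv => /rcons_inj[].
  rewrite -ge0_sume_distrr; last first.
    move=> y _; rewrite lee_fin mulr_ge0 ?exprn_ge0 //.
    by case: ifP => // _; exact: K_ge0.
  apply: lee_wpmul2l => //; rewrite sumEFin lee_fin -mulr_suml exprS.
  apply: ler_wpM2r; first exact: exprn_ge0.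
  rewrite -(K_sum h xX) (big_rem u uX) /= eqxx add0r [X in _ <= X - _](big_rem u uX) /=.
  have -> : \sum_(y <- rem u X) (if y == u then 0 else K h x y) =
      \sum_(y <- rem u X) K h x y.
    rewrite big_seq [RHS]big_seq; apply: eq_bigr => y.
    by rewrite mem_rem_uniq ?fset_uniq // !inE => /andP[/negbTE -> _].
  by rewrite addrAC lerDr subr_ge0 xv.
apply: (@le_trans _ _ (\sum_(y <- X) P (cyl h x) *
      (K h x y * (1 - p) ^+ k.+1)%:E)%E).
  rewrite big_seq [leRHS]big_seq; apply: lee_sum => y yX.
  rewrite EFinM muleA -prob_cyl_rcons; apply: le_trans (IH k.+1 _ _ yX).
  apply: le_measure; rewrite ?inE.
  - exact: measurableI.
  - by apply: measurableI => //; exact: measurable_misses.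
  rewrite size_rcons => rho [] + [[[+ _] _]|[_]] //; rewrite cyl_rcons.
  move=> [+ _]; rewrite /cyl /= mkseqS => /rcons_inj[_ ->] e.
  by rewrite e eqxx in xv.
rewrite -ge0_sume_distrr; last first.
  by move=> y _; rewrite lee_fin mulr_ge0 ?exprn_ge0 // K_ge0.
by rewrite sumEFin -mulr_suml K_sum // mul1r.
Qed.

Lemma prob_misses_from n k N :
  (P (misses n k N) <= ((1 - p) ^+ k)%:E)%E.
Proof.
have q0 : 0 <= 1 - p by rewrite subr_ge0 transfer_le1.
(* The window opens [d] steps after the cylinder; averaging over the next vertex lowers [d] to 0. *)
have H d h x : x \in X ->
    (P (cyl h x `&` misses n k (size h + d)) <= P (cyl h x) * ((1 - p) ^+ k)%:E)%E.
  elim: d h x => [|d IH] h x xX; first by rewrite addn0 prob_misses_cyl.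
  rewrite prob_cyl_split //; last exact: measurable_misses.
  apply: (@le_trans _ _ (\sum_(y <- X) P (cyl h x) *
      (K h x y * (1 - p) ^+ k)%:E)%E).
    rewrite big_seq [leRHS]big_seq; apply: lee_sum => y yX.
    rewrite EFinM muleA -prob_cyl_rcons; apply: le_trans (IH _ _ yX).
    by rewrite size_rcons addnS addSn.
  rewrite -ge0_sume_distrr; last first.
    by move=> y _; rewrite lee_fin mulr_ge0 ?exprn_ge0 // K_ge0.
  by rewrite sumEFin -mulr_suml K_sum // mul1r.
have := H N [::] x0 x0X; rewrite prob_cyl_nil eqxx mul1e; apply: le_trans.
have mM := measurable_misses n k N.
have PC0 : P (~` cyl [::] x0) = 0%E.
  by rewrite probability_setC // prob_cyl_nil eqxx subee.
have -> : P (misses n k N) =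
    P ((cyl [::] x0 `&` misses n k N) `|` (~` cyl [::] x0 `&` misses n k N)).
  by rewrite -setIUl setUv setTI.
rewrite measureU0 ?add0n //.
- exact: measurableI.
- by apply: measurableI => //; exact: measurableC.
apply: (subset_measure0 (B := ~` cyl [::] x0)) => //.
- by apply: measurableI => //; exact: measurableC.
- exact: measurableC.
Qed.

Lemma missesS n k m : misses n k m `<=` misses n.+1 k m.
Proof.
elim: n k m => [|n IH] [|k] m; [by []|by move=> rho| by []|].
move=> rho [[? h]|[? h]]; [left|right]; split=> //; exact: IH.
Qed.

Lemma visited_io_misses (rho : plays V) N k : visited_io rho v ->
  (forall m, (N <= m)%N -> rho m = v -> rho m.+1 <> u) ->
  exists n, misses n k N rho.
Proof.
move=> io; elim: k N => [|k IH] N nxt; first by exists 0%N.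
have [m Nm rm] := io N.
(* Inner induction on the distance to a known visit [m], to pass the steps before the next visit. *)
have [d] := ubnP (m - N)%N; elim: d N nxt Nm => // d IHd N nxt Nm dlt.
have nxt' m' : (N.+1 <= m')%N -> rho m' = v -> rho m'.+1 <> u.
  by move=> le; apply: nxt; exact: ltnW.
have [rN|rN] := pselect (rho N = v).
  have [n hn] := IH N.+1 nxt'.
  by exists n.+1; left; split=> //; split=> //; exact: nxt.
have NM : (N < m)%N.
  by rewrite ltn_neqAle Nm andbT; apply/eqP => e; apply: rN; rewrite e.
have [|n hn] := IHd N.+1 nxt' NM; last by exists n.+1; right.
by rewrite subnS; move: dlt; case: (m - N)%N (subn_gt0 N m) => [|j]; rewrite ?NM.
Qed.

(** A play that visits [v] infinitely often but never [u] from [N] on has arbitrarily many misses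
    after [N]. For fixed [N] this has probability at most [(1 - p) ^+ k] for every [k], hence 0. *)
Lemma ae_transfer : \forall rho \ae P, visited_io rho v -> visited_io rho u.
Proof.
have q0 : 0 <= 1 - p by rewrite subr_ge0 transfer_le1.
pose C N := \bigcap_k \bigcup_n misses n k N.
have mU k N : measurable (\bigcup_n misses n k N).
  by apply: bigcupT_measurable => n; exact: measurable_misses.
have mC N : measurable (C N) by exact: bigcapT_measurable.
have PC N : P (C N) = 0%E.
  have le k : (P (C N) <= ((1 - p) ^+ k)%:E)%E.
    apply: (@le_trans _ _ (P (\bigcup_n misses n k N))).
      by apply: le_measure; rewrite ?inE //; exact: bigcap_inf.
    (* Continuity from below: [misses n k N] grows with the horizon [n]. *)
    have cv := @nondecreasing_cvg_mu _ _ _ P (fun n => misses n k N).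
    rewrite -(cvg_lim _ (cv _ _ _)) //; last first.
    - apply/nondecreasing_seqP => n; rewrite subsetEset; exact: missesS.
    - by move=> n; exact: measurable_misses.
    apply: lime_le.
      apply/cvg_ex; eexists; apply: cv => //.
      - by move=> n; exact: measurable_misses.
      - apply/nondecreasing_seqP => n; rewrite subsetEset; exact: missesS.
    by apply: nearW => n; exact: prob_misses_from.
  have fC : P (C N) \is a fin_num by exact: fin_num_measure.
  apply/eqP; rewrite eq_le measure_ge0 andbT -(fineK fC) lee_fin.
  have cv : (1 - p) ^+ k @[k --> \oo] --> 0.
    by apply: cvg_expr; rewrite ger0_norm // ltrBlDr ltrDl.
  rewrite -(cvg_lim _ cv) //; apply: limr_ge; first exact: cvgP cv.
  by apply: nearW => k; rewrite -lee_fin fineK.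
have : \forall rho \ae P, forall N, ~ C N rho.
  apply: ae_foralln => N; exists (C N); split.
  - exact: mC.
  - exact: PC.
  - by move=> rho /= /contrapT.
move=> aeC; have aeF := ae_filter_ringOfSetsType P.
apply: filterS aeC => rho nC io N.
apply: contrapT => nu; apply: (nC N) => k _.
have [n hn] : exists n, misses n k N rho; last by exists n.
apply: visited_io_misses io _ => m Nm rm e; apply: nu.
by exists m.+1 => //; exact: (leq_trans Nm).
Qed.

End Transfer.
End Process.

(** * Existence of the play measure *)

Section Cells.
Variables (R : realType) (V : pointedType) (k : V -> R).

(* The intervals [cell_low s a y, cell_low s a y + k y[ for [y] in [s] are consecutive and
   start at [a]; [pick_cell s a z] is the [y] whose interval contains [z]. *)
Fixpoint pick_cell (s : seq V) (a z : R) : V :=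
  if s is y :: s' then if z < a + k y then y else pick_cell s' (a + k y) z
  else point.

Fixpoint cell_low (s : seq V) (a : R) (y : V) : R :=
  if s is u :: s' then if y == u then a else cell_low s' (a + k u) y else a.

Hypothesis k_ge0 : forall y, 0 <= k y.

Lemma cell_low_ge s a y : a <= cell_low s a y.
Proof.
elim: s a => //= u s IH a; case: eqP => // _.
by apply: le_trans (IH _); rewrite lerDl.
Qed.

Lemma cell_low_le s a y : y \in s -> cell_low s a y + k y <= a + \sum_(u <- s) k u.
Proof.
elim: s a => //= u s IH a; rewrite inE big_cons addrA.
have [->|yu] /= := eqVneq y u; last exact: IH.
by rewrite lerDl sumr_ge0.
Qed.

Lemma pick_cell_mem s a z : a <= z < a + \sum_(u <- s) k u -> pick_cell s a z \in s.
Proof.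
elim: s a => [|u s IH] a /=.
  by rewrite big_nil addr0 => /andP[h1 h2]; have := le_lt_trans h1 h2; rewrite ltxx.
rewrite big_cons addrA inE => /andP[az zlt].
case: ltP => [_|le]; first by rewrite eqxx.
by rewrite IH ?orbT // le.
Qed.

Lemma pick_cellP s a z y : uniq s -> y \in s -> a <= z < a + \sum_(u <- s) k u ->
  pick_cell s a z = y <-> cell_low s a y <= z < cell_low s a y + k y.
Proof.
elim: s a => //= u s IH a /andP[us uqs]; rewrite inE big_cons addrA.
have [->|yu] /= := eqVneq y u.
  move=> _ /andP[az zlt]; rewrite az /=; case: ltP => // le; split=> // e.
  exfalso; move: us; rewrite -{1}e => /negP; apply.
  by apply: pick_cell_mem; rewrite le.
move=> ys /andP[az zlt]; case: ltP => [lt|le].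
  split=> [e|/andP[le _]]; first by rewrite e eqxx in yu.
  by have := lt_le_trans lt (le_trans (cell_low_ge _ _ _) le); rewrite ltxx.
by apply: IH; rewrite ?le.
Qed.

End Cells.

Section Existence.
Variables (R : realType) (V : pointedType) (X : {fset V}) (x0 : V).
Variable K : seq V -> V -> V -> R.
Hypothesis x0X : x0 \in X.
Hypothesis K_ge0 : forall h x y, x \in X -> 0 <= K h x y.
Hypothesis K_sum : forall h x, x \in X -> \sum_(y <- X) K h x y = 1.
Hypothesis K_out : forall h x y, x \in X -> y \notin X -> K h x y = 0.

(* The cylinder of the first [n + 1] vertices of [r] is realized by the interval
   of the given left end and length. *)
Fixpoint itv_of (r : nat -> V) (n : nat) : R * R :=
  if n is m.+1 then
    let k y := (itv_of r m).2 * K (mkseq r m) (r m) y in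
    (cell_low k X (itv_of r m).1 (r n), k (r n))
  else (0, 1).

(** Besides history and vertex, the state carries the left end and length of the current
    subinterval, which contains [z] whenever [z] lies in the unit interval. *)
Fixpoint run (z : R) (n : nat) : seq V * V * (R * R) :=
  if n is m.+1 then
    let: (h, x, (a, p)) := run z m in
    let k y := p * K h x y in
    let y := pick_cell k X a z in (rcons h x, y, (cell_low k X a y, k y))
  else ([::], x0, (0, 1)).

Definition run_play (z : R) (n : nat) : V := (run z n).1.2.

Lemma runE z n : run z n = (mkseq (run_play z) n, run_play z n, itv_of (run_play z) n).
Proof.
elim: n => // n IH; rewrite mkseqS.
have e : run_play z n.+1 = (run z n.+1).1.2 by [].
rewrite [itv_of _ _]/= e /= IH.
by case: (itv_of (run_play z) n).
Qed.

Lemma run_playS z n : run_play z n.+1 =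
  pick_cell (fun y => (itv_of (run_play z) n).2 * K (mkseq (run_play z) n) (run_play z n) y)
    X (itv_of (run_play z) n).1 z.
Proof.
have e : run_play z n.+1 = (run z n.+1).1.2 by [].
by rewrite e /= runE; case: (itv_of (run_play z) n).
Qed.

Lemma eq_mkseq_prefix (r r' : nat -> V) n :
  (forall i, (i < n)%N -> r i = r' i) -> mkseq r n = mkseq r' n.
Proof. by move=> e; apply/eq_in_map => i; rewrite mem_iota => /e. Qed.

Lemma itv_of_ext r r' n : (forall i, (i <= n)%N -> r i = r' i) ->
  itv_of r n = itv_of r' n.
Proof.
elim: n => //= n IH e; rewrite IH; last by move=> i /leqW/e.
by rewrite !e // (@eq_mkseq_prefix r r') // => i /ltnW/leqW/e.
Qed.

Lemma itv_of_ge0 r n : (forall i, (i <= n)%N -> r i \in X) -> 0 <= (itv_of r n).2.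
Proof.
elim: n => //= n IH e; rewrite mulr_ge0 //; last by apply: K_ge0; exact: e.
by apply: IH => i /leqW/e.
Qed.

Lemma itv_of_mass r n :
  (itv_of r n).2 = \prod_(i < n) K (mkseq r i) (r i) (r i.+1).
Proof. by elim: n => [|n IH] /=; rewrite ?big_ord0 // big_ord_recr /= IH. Qed.

(** The cells of the successors partition the interval of the prefix, as the weights of [K] sum to
    1; so following [r] one step further means lying in the cell of [r n.+1]. *)
Lemma run_play_itv z r n : 0 <= z < 1 -> r 0%N = x0 ->
  (forall i, (i <= n)%N -> r i \in X) ->
  (forall i, (i <= n)%N -> run_play z i = r i) <->
  (itv_of r n).1 <= z < (itv_of r n).1 + (itv_of r n).2.
Proof.
move=> z01 r0; elim: n => [|n IH] rX.
  by rewrite /= add0r z01; split=> // _ i; rewrite leqn0 => /eqP ->.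
have rX' i : (i <= n)%N -> r i \in X by move=> /leqW/rX.
have {}IH := IH rX'.
set a := (itv_of r n).1 in IH *; set p := (itv_of r n).2 in IH *.
pose k y := p * K (mkseq r n) (r n) y.
have k_ge0 y : 0 <= k y by rewrite mulr_ge0 ?itv_of_ge0 // K_ge0 // rX'.
have k_sum : \sum_(y <- X) k y = p by rewrite -mulr_sumr K_sum ?mulr1 // rX'.
have nextE : (forall i, (i <= n)%N -> run_play z i = r i) ->
    run_play z n.+1 = pick_cell k X a z.
  move=> e; rewrite run_playS (itv_of_ext e) -/a -/p.
  by rewrite (e n) // (@eq_mkseq_prefix _ r) // => i /ltnW/e.
have step : itv_of r n.+1 = (cell_low k X a (r n.+1), k (r n.+1)) by [].
rewrite step /=; split.
  move=> e; have e' i : (i <= n)%N -> run_play z i = r i by move=> /leqW/e.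
  apply/pick_cellP => //; first exact: fset_uniq.
  - exact: rX.
  - by rewrite k_sum; apply/IH.
  - by rewrite -nextE // e.
move=> zin; have zpar : a <= z < a + p.
  case/andP: zin => z1 z2; apply/andP; split; first exact: le_trans (cell_low_ge _ _ _ _) z1.
  by apply: (lt_le_trans z2); rewrite -k_sum cell_low_le // rX.
have e' := IH.2 zpar => i; rewrite leq_eqVlt => /predU1P[->|]; last exact: e'.
rewrite nextE //; apply/pick_cellP => //; first exact: fset_uniq.
- exact: rX.
- by rewrite k_sum.
Qed.

Lemma run_play_mem z n : 0 <= z < 1 -> run_play z n \in X.
Proof.
move=> z01; have [m] := ubnP n; elim: m n => // m IH [|n] nm; first exact: x0X.
have rX i : (i <= n)%N -> run_play z i \in X.
  by move=> ile; apply: IH; exact: leq_ltn_trans ile _.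
have /(@run_play_itv z (run_play z) n z01 erefl rX) zin :
  forall i, (i <= n)%N -> run_play z i = run_play z i by [].
rewrite run_playS; apply: pick_cell_mem.
by rewrite -mulr_sumr K_sum ?mulr1 // rX.
Qed.

Lemma itv_of_sub r n z : r 0%N = x0 -> (forall i, (i <= n)%N -> r i \in X) ->
  (itv_of r n).1 <= z < (itv_of r n).1 + (itv_of r n).2 -> 0 <= z < 1.
Proof.
move=> r0; elim: n => [|n IH] rX; first by rewrite /= add0r.
have rX' i : (i <= n)%N -> r i \in X by move=> /leqW/rX.
move=> /= /andP[z1 z2]; apply: IH => //.
have k_ge0 y : 0 <= (itv_of r n).2 * K (mkseq r n) (r n) y.
  by rewrite mulr_ge0 ?itv_of_ge0 // K_ge0 // rX'.
rewrite (le_trans (cell_low_ge k_ge0 _ _ _) z1) /=; apply: (lt_le_trans z2).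
by apply: le_trans (cell_low_le k_ge0 _ (rX _ _)) _ => //; rewrite -mulr_sumr K_sum ?mulr1 // rX'.
Qed.

(** Points outside the unit interval get a default play; the law gives them no mass. *)
Definition sample (z : R) : plays V := if 0 <= z < 1 then run_play z else fun=> x0.

Lemma sample_prefix r n : r 0%N = x0 -> (forall i, (i <= n)%N -> r i \in X) ->
  [set z | 0 <= z < 1 /\ forall i, (i <= n)%N -> sample z i = r i] =
  [set` `[(itv_of r n).1, (itv_of r n).1 + (itv_of r n).2[].
Proof.
move=> r0 rX; apply/seteqP; split=> z /=; rewrite in_itv /=.
  by move=> [z01]; rewrite /sample z01 => /run_play_itv; apply.
move=> zin; have z01 := itv_of_sub r0 rX zin; split=> //.
by rewrite /sample z01; apply/run_play_itv.
Qed.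

(** The preimage of a coordinate event is a finite union of intervals, one for each word of length
    [n + 1] over [X] from [x0] to [v], plus the complement of the unit interval when [x0 = v]. *)
Lemma measurable_sample :
  measurable_fun setT (sample : measurableTypeR R -> plays V).
Proof.
apply: (@measurability _ _ (measurableTypeR R) (plays V) _ _ (@cylinders V)) => //.
move=> _ [_ [n [v ->]] <-]; rewrite setTI.
pose r (s : n.+1.-tuple X) := nth x0 (map val s).
pose D := [set s : n.+1.-tuple X | r s 0%N = x0 /\ r s n = v].
have rX s i : (i <= n)%N -> r s i \in X.
  move=> ile; rewrite /r.
  have lt : (i < size (map val s))%N by rewrite size_map size_tuple.
  by have /mapP[y _ ->] := mem_nth x0 lt; exact: valP.
rewrite (_ : _ @^-1` _ =
     (\bigcup_(s in D) [set` `[(itv_of (r s) n).1, (itv_of (r s) n).1 + (itv_of (r s) n).2[])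
  `|` (~` [set` `[0, 1[] `&` [set _ | x0 = v])).
  apply: measurableU.
    apply: fin_bigcup_measurable => [|s _]; last exact: measurable_itv.
    exact: finite_finset.
  apply: measurableI; first by apply: measurableC; exact: measurable_itv.
  have [e|e] := pselect (x0 = v).
    by rewrite (_ : mkset _ = setT) //; apply/seteqP; split.
  by rewrite (_ : mkset _ = set0) //; apply/seteqP; split.
apply/seteqP; split=> z /=.
  have [z01|z01] := boolP (0 <= z < 1); last first.
    by rewrite /sample (negbTE z01) => e; right; rewrite in_itv /= (negbTE z01).
  move=> e; left.
  have sz : size [seq [` run_play_mem i z01]%fset | i <- iota 0 n.+1] == n.+1.
    by rewrite size_map size_iota.
  have er i : (i <= n)%N -> r (Tuple sz) i = run_play z i.
    move=> ile; rewrite /r (_ : map _ _ = mkseq (run_play z) n.+1) ?nth_mkseq //.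
    by rewrite /mkseq -map_comp.
  exists (Tuple sz); first by split; rewrite er // -e /sample z01.
  have rs0 : r (Tuple sz) 0%N = x0 by rewrite er.
  have /seteqP[sub _] := sample_prefix rs0 (rX (Tuple sz)); apply: sub.
  by split=> // i ile; rewrite er // /sample z01.
move=> [[s [s0 sn]]|[]]; last by rewrite in_itv /sample /= => /negP/negbTE -> <-.
have /seteqP[_ sub] := sample_prefix s0 (rX s).
by move=> /sub[_ /(_ _ (leqnn n)) ->].
Qed.

(** The first step that leaves [X] contributes a factor 0. *)
Lemma prod_steps_out r n : r 0%N \in X -> (exists2 i, (i <= n)%N & r i \notin X) ->
  \prod_(i < n) K (mkseq r i) (r i) (r i.+1) = 0.
Proof.
move=> r0; elim: n => [|n IH] [i ile ri].
  by move: ri; move: ile; rewrite leqn0 => /eqP ->; rewrite r0.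
rewrite big_ord_recr /=.
have [ex|nex] := pselect (exists2 i, (i <= n)%N & r i \notin X).
  by rewrite IH // mul0r.
rewrite K_out ?mulr0 //.
  by apply: contrapT => /negP h; apply: nex; exists n.
move: ile; rewrite leq_eqVlt => /predU1P[<- //|ile].
by exfalso; apply: nex; exists i.
Qed.

Let measurable_unit : measurable ([set` `[0, 1[] : set (measurableTypeR R)).
Proof. exact: measurable_itv. Qed.

Definition sample_law : set (plays V) -> \bar R :=
  pushforward (mrestr (@lebesgue_measure R) measurable_unit)
    (sample : measurableTypeR R -> plays V).

Let sample_law_measure :
  exists m : {measure set (plays V) -> \bar R}, m = sample_law :> (_ -> _).
Proof.
pose m : {measure set (plays V) -> \bar R} := pushforward
  (mrestr (@lebesgue_measure R) measurable_unit)
  (sample : measurableTypeR R -> plays V).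
by exists (m measurable_sample).
Qed.

Let sample_law0 : sample_law set0 = 0%E.
Proof. by have [m <-] := sample_law_measure; exact: measure0. Qed.

Let sample_law_ge0 A : (0 <= sample_law A)%E.
Proof. by have [m <-] := sample_law_measure; exact: measure_ge0. Qed.

Let sample_law_sigma_additive : semi_sigma_additive sample_law.
Proof.
by have [m <-] := sample_law_measure; exact: measure_semi_sigma_additive.
Qed.

HB.instance Definition _ := isMeasure.Build _ _ _ sample_law
  sample_law0 sample_law_ge0 sample_law_sigma_additive.

Let sample_lawT : sample_law setT = 1%E.
Proof.
rewrite /sample_law /pushforward /mrestr preimage_setT setTI.
by rewrite lebesgue_measure_itv /= lte_fin ltr01 oppr0 adde0.
Qed.

HB.instance Definition _ :=
  Measure_isProbability.Build _ _ _ sample_law sample_lawT.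

(* Ionescu-Tulcea for a kernel that lives on a finite set: the play is sampled
   from a uniform point of [0, 1[ by nested subdivisions. *)
Lemma process_exists : exists P : probability (plays V) R, forall r n,
  P [set rho : plays V | forall i, (i <= n)%N -> rho i = r i] =
  ((r 0%N == x0)%:R * \prod_(i < n) K (mkseq r i) (r i) (r i.+1))%:E.
Proof.
exists sample_law => r n.
transitivity (lebesgue_measure
    [set z : R | 0 <= z < 1 /\ forall i, (i <= n)%N -> sample z i = r i]).
  rewrite /= /sample_law /pushforward /mrestr; congr (lebesgue_measure _).
  by apply/seteqP; split=> z /=; rewrite in_itv /= => -[].
have [r0|r0] := eqVneq (r 0%N) x0; last first.
  rewrite mul0r (_ : mkset _ = set0) ?measure0 //.
  rewrite -subset0 => z [z01 /(_ 0%N isT)]; rewrite /sample z01 => e.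
  by rewrite -e eqxx in r0.
rewrite mul1r.
have [rX|nrX] := pselect (forall i, (i <= n)%N -> r i \in X); last first.
  have [i ile ri] : exists2 i, (i <= n)%N & r i \notin X.
    apply: contrapT => nex; apply: nrX => i ile.
    by apply: contrapT => /negP h; apply: nex; exists i.
  rewrite prod_steps_out ?r0 //; last by exists i.
  rewrite (_ : mkset _ = set0) ?measure0 //.
  rewrite -subset0 => z [z01 /(_ i ile)]; rewrite /sample z01 => e.
  by move: ri; rewrite -e run_play_mem.
(* The prefix interval has the product of the steps as its length; length 0 means an empty
   interval. *)
rewrite sample_prefix // lebesgue_measure_itv /= lte_fin ltrDl -itv_of_mass.
have := itv_of_ge0 rX; rewrite le_eqVlt => /predU1P[<-|->]; first by rewrite ltxx.
by rewrite -EFinB addrAC subrr add0r.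
Qed.

End Existence.

(** * The snippet and the symbolic graph *)

Section FixedPoints.
Variables (R : realType) (Sigma F : finType).
Variables (A : pts R Sigma) (A' : pts R (Sigma + F)%type).
Implicit Types C Y : set (svertex A A').

Lemma least_closed_base pre C : C `<=` least_closed pre C.
Proof. by move=> v Cv Y [CY _]; exact: CY. Qed.

Lemma least_closed_ind pre C Y : C `<=` Y -> pre Y `<=` Y -> least_closed pre C `<=` Y.
Proof. by move=> CY preY v; apply. Qed.

(** Knaster-Tarski: each closed set above [C] contains the intersection, hence by monotonicity also
    its predecessors. *)
Lemma least_closed_closed pre C : (forall Y Y', Y `<=` Y' -> pre Y `<=` pre Y') ->
  pre (least_closed pre C) `<=` least_closed pre C.
Proof.
move=> mono v pv Y [CY preY]; apply: (preY); move: pv; apply: (mono) => u; exact.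
Qed.

Lemma exPre_mono C Y : C `<=` Y -> exPre C `<=` exPre Y.
Proof. by move=> CY v [vv [u [vu Cu]]]; split=> //; exists u; split=> //; exact: CY. Qed.

(** The forbidden sum for [C] has nonnegative terms and is bounded by the one for [Y], which is
    0. *)
Lemma Eq_solution_mono mu mu' C Y x : C `<=` Y ->
  Eq_solution mu mu' Y x -> Eq_solution mu mu' C x.
Proof.
move=> CY [m1 m2 pos s0]; split=> //.
apply/eqP; rewrite eq_le sumr_ge0 ?andbT; last first.
  by move=> t tm; apply: sumr_ge0 => t' /andP[t'm _]; exact: pos.
rewrite -[leRHS]s0; apply: ler_sum => t tm.
rewrite big_mkcondr [leRHS]big_mkcondr; apply: ler_sum => t' t'm.
case: asboolP => [/CY cy|_]; case: asboolP => // _; exact: pos.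
Qed.

Lemma allPre_mono C Y : C `<=` Y -> allPre C `<=` allPre Y.
Proof.
move=> CY v [vv pv]; split=> //; move: pv; case: (sg_owner v).
- by move=> [u [vu Cu]]; exists u; split=> //; exact: CY.
- by move=> sub; exact: subset_trans sub CY.
- move=> [s [s' [mu [mu' [-> ns]]]]]; exists s, s', mu, mu'; split=> // -[x xs].
  by apply: ns; exists x; exact: Eq_solution_mono xs.
Qed.

(** The system constrains [x] only on the two supports, so [x] is extended by 0. A vanishing sum of
    nonnegative terms makes each forbidden entry vanish. *)
Lemma Eq_solution_coupling mu mu' C x : Eq_solution mu mu' C x ->
  exists2 w : dist R (state A * state A')%type, couplings mu mu' w &
    forall t t', w (t, t') != 0 -> ~ C (SR t t').
Proof.
move=> [m1 m2 pos s0].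
pose f (p : state A * state A') :=
  if (p.1 \in supp mu) && (p.2 \in supp mu') then x p.1 p.2 else 0.
have f1 t : \sum_t' f (t, t') = mu t.
  have [tm|tm] := boolP (t \in supp mu).
    by rewrite -m1 // [RHS]big_mkcond; apply: eq_bigr => t' _; rewrite /f /= tm.
  rewrite big1 => [|t' _]; last by rewrite /f /= (negbTE tm).
  by move: tm; rewrite inE negbK => /eqP.
have f2 t' : \sum_t f (t, t') = mu' t'.
  have [tm|tm] := boolP (t' \in supp mu').
    rewrite -m2 // [RHS]big_mkcond; apply: eq_bigr => t _; rewrite /f /= tm andbT.
    by case: ifP.
  rewrite big1 => [|t _]; last by rewrite /f /= (negbTE tm) andbF.
  by move: tm; rewrite inE negbK => /eqP.
have f0 p : 0 <= f p.
  by rewrite /f; case: ifP => // /andP[? ?]; exact: pos.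
have fs : \sum_p f p = 1.
  rewrite -(dist_sum1 mu) -(eq_bigr _ (fun t _ => f1 t)) pair_bigA /=.
  by apply: eq_bigr => -[].
have [w wf] := dist_of_fun f0 fs.
exists w; first by split=> t; under eq_bigr do rewrite wf.
move=> t t'; rewrite wf /f /=; case: ifP; rewrite ?eqxx // => /andP[tm tm'] xn Ctt.
have s1 : \sum_(t'0 in supp mu' | `[< C (SR t t'0) >]) x t t'0 = 0.
  have := s0; move/psumr_eq0P; apply=> //.
  by move=> u um; apply: sumr_ge0 => u' /andP[um' _]; exact: pos.
have := s1; move/psumr_eq0P => /(_ _ t') s2.
move/eqP: xn; apply; apply: s2; last by rewrite tm'; apply/asboolP.
by move=> u' /andP[um' _]; exact: pos.
Qed.

End FixedPoints.

Section Snippet.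
Variables (R : realType) (Sigma F : finType).
Variables (A : pts R Sigma) (A' : pts R (Sigma + F)%type).
Local Notation G := (vertex_snippet A A').
Local Notation err := (GErr A A').

Definition proj (g : gvertex A A') : svertex A A' :=
  match g with
  | GR s s' => SR s s'
  | GErr => SErr A A'
  | GV1 s a s' mu => SV1 s a s' mu
  | GV2 s a s' mu' => SV2 s a s' mu'
  | GP s s' mu mu' _ => SP s s' mu mu'
  end.

(** Distributions come from finitely many transitions, or are Dirac after a fault, and each pair has
    finitely many extreme couplings. *)
Lemma finite_snippet : finite_set (vertex_set G).
Proof.
pose TA := [set x | trans (p := A) x.1.1 x.1.2 x.2].
pose TA' := [set x | trans (p := A') x.1.1 x.1.2 x.2].
have fT : finite_set TA := trans_finite A.
have fT' : finite_set TA' := trans_finite A'.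
pose DA := snd @` TA `|` range (@dirac_dist R (state A)).
pose DA' := snd @` TA'.
apply: (@sub_finite_set _ _ (
   (\bigcup_s \bigcup_s' [set GR s s']) `|` [set err] `|`
   (\bigcup_(x in TA) \bigcup_s' [set GV1 x.1.1 x.1.2 s' x.2]) `|`
   (\bigcup_(x in TA') \bigcup_s [set GV2 s x.1.2 x.1.1 x.2]) `|`
   (\bigcup_s \bigcup_s' \bigcup_(mu in DA) \bigcup_(mu' in DA')
      (GP s s' mu mu' @` extreme_points (couplings mu mu'))))).
  move=> [s s' | | s a s' mu|s a s' mu'|s s' mu mu' w] [/= vg We].
  - by do 4 left; exists s => //; exists s'.
  - by do 3 left; right.
  - by do 2 left; right; exists (s, a, mu) => //; exists s'.
  - by left; right; exists (s', a, mu') => //; exists s.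
  - right; exists s => //; exists s' => //; exists mu.
      move: vg => [[[a [t _]]|[f [-> _]]] _]; last by right; exists s.
      by left; exists (s, a, mu).
    exists mu'; last by exists w.
    move: vg => [[[a [_ t]]|[f [_ t]]] _]; first by exists (s', inl a, mu').
    by exists (s', inr f, mu').
have fS (T : finType) : finite_set [set: T] by exact: finite_finset.
rewrite !finite_setU; do !split.
- by do 2 (apply: bigcup_finite => // ? _).
- exact: finite_set1.
- by do 2 (apply: bigcup_finite => // ? _).
- by do 2 (apply: bigcup_finite => // ? _).
- apply: bigcup_finite => // s _; apply: bigcup_finite => // s' _.
  apply: bigcup_finite => [|mu _].
    by rewrite finite_setU; split; apply: finite_image.
  apply: bigcup_finite => [|mu' _]; first exact: finite_image.
  exact/finite_image/finite_extreme_couplings.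
Qed.

Lemma proj_vertex g : vertex_set G g -> sg_vertices A A' (proj g).
Proof. by case: g => [s s' | | s a s' mu|s a s' mu'|s s' mu mu' w] [] //= []. Qed.

(** The product coupling always exists, so couplings never block the Verifier; with [proj_move],
    dead ends of game and symbolic graph correspond. Dead ends refer to [masking_move], so the
    coupling need not be extreme. *)
Lemma sg_move_lift g u : masking_owner g = Verifier -> sg_move (proj g) u ->
  exists x, masking_move g x.
Proof.
case: g => [s s' | | s a s' mu|s a s' mu'|s s' mu mu' w] //= _ mv; inversion mv; subst.
- have [w [cw _]] := product_coupling mu mu'.
  by exists (GP s s' mu mu' w); exact: MoveV1.
- have [w [cw _]] := product_coupling mu mu'.
  by exists (GP s s' mu mu' w); exact: MoveV2.
- have [w [cw _]] := product_coupling (dirac_dist R s) mu'.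
  by exists (GP s s' (dirac_dist R s) mu' w); exact: MoveVF.
Qed.

Lemma proj_move g x : vertex_set G g -> masking_move g x -> sg_move (proj g) (proj x).
Proof.
move=> vg mv; case: mv vg => /=; try by constructor.
move=> s s' mu mu' w t t' wn [[/= _ cw] _].
by have /andP[? ?] := coupling_supp cw wn; constructor.
Qed.

Lemma proj_owner g : sg_owner (proj g) = masking_owner g.
Proof. by case: g. Qed.

Lemma proj_edge g g' : vertex_set G g -> edge G g g' -> sg_edge (proj g) (proj g').
Proof.
move=> vg [_ _ [mv|[po st ->]]]; first by left; exact: proj_move.
right; split=> //; first by rewrite proj_owner.
by move=> [u /(sg_move_lift po)].
Qed.

Lemma edge_vertex g g' : vertex_set G g -> edge G g g' -> vertex_set G g'.
Proof.
move=> [/= vg Wg] [_ Wg' [mv|[_ _ ->]]] //; split=> //.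
case: mv vg {Wg Wg'} => //= s s' a.
- by move=> mu mu' w tr cw tr'; split=> //; left; exists a.
- by move=> mu mu' w tr cw tr'; split=> //; left; exists a.
- by move=> mu' w cw tr; split=> //; right; exists a.
Qed.

(** Probabilistic vertices are excluded: a symbolic edge only asks for [t] and [t'] in the supports,
    and the coupling at hand may give the pair weight 0. *)
Lemma lift_edge g g' : vertex_set G g -> vertex_set G g' ->
  owner_of G g <> Probabilistic -> sg_edge (proj g) (proj g') -> edge G g g'.
Proof.
move=> vg [vg' Wg'] og [mv|[po st e]]; split=> //; [by case: vg|  |by case: vg|].
  left; case: g vg mv og => [s s' | | s a s' mu|s a s' mu'|s s' mu mu' w] vg /= mv og //;
  case: g' vg' {Wg'} mv => [t t' | | t b t' nu|t b t' nu'|t t' nu nu' w'] /= vg' mv;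
  inversion mv; subst; constructor => //; by case: vg'.
right; split=> //; first by rewrite -proj_owner.
  by move=> [x mv]; apply: st; exists (proj x); exact: proj_move.
by case: g' e {vg' Wg'}.
Qed.

Lemma lift_vertex v : sg_vertices A A' v -> exists2 g, proj g = v & vertex_set G g.
Proof.
case: v => [s s' | | s a s' mu|s a s' mu'|s s' mu mu'] vv.
- by exists (GR s s').
- by exists err.
- by exists (GV1 s a s' mu).
- by exists (GV2 s a s' mu').
- have [w ew] := extreme_coupling_exists mu mu'.
  by exists (GP s s' mu mu' w) => //; split=> //; split=> //; case: ew.
Qed.

Lemma sg_edge_vertex v u : sg_vertices A A' v -> sg_edge v u -> sg_vertices A A' u.
Proof.
move=> vv [mv|[_ _ ->]] //; case: mv vv => //= s s' a.
- by move=> mu mu' t t'; left; exists a.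
- by move=> mu mu' t t'; left; exists a.
- by move=> mu' t'; right; exists a.
Qed.

Lemma edge_exists g : vertex_set G g -> owner_of G g <> Probabilistic ->
  exists g', edge G g g'.
Proof.
move=> vg og.
have [u vu] : exists u, sg_edge (proj g) u.
  case: g {og} vg (og) => [s s' | | s a s' mu|s a s' mu'|s s' mu mu' w] vg og //.
  - have [a [mu tr]] := trans_total s.
    by exists (SV1 s a s' mu); left; constructor.
  - by exists (SErr A A'); left; constructor.
  - have [[u mv]|st] := pselect (exists u, sg_move (SV1 (A' := A') s a s' mu) u).
      by exists u; left.
    by exists (SErr A A'); right.
  - have [[u mv]|st] := pselect (exists u, sg_move (SV2 (A := A) s a s' mu') u).
      by exists u; left.
    by exists (SErr A A'); right.
have [g' eg' vg'] := lift_vertex (sg_edge_vertex (proj_vertex vg) vu).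
by exists g'; apply: lift_edge => //; rewrite eg'.
Qed.

(** * The kernel that two strategies induce on the snippet *)

Section Kernel.
Variables (piR piV : strategy R (gvertex A A')).
Hypotheses (sR : is_strategy G Refuter piR) (sV : is_strategy G Verifier piV).
Variable X : {fset gvertex A A'}.
Hypothesis eX : vertex_set G = [set` X].

Let inX g : (g \in X) <-> vertex_set G g.
Proof. by rewrite eX. Qed.

Lemma step_edge h x y : vertex_set G x -> step G piR piV h x y != 0 -> edge G x y.
Proof.
rewrite /step => vx; case e: (owner_of G x).
- by have [_ ed _] := sR h vx e; exact: ed.
- by have [_ ed _] := sV h vx e; exact: ed.
- case: x vx e => // s s' mu mu' w [_ W] _; case: y => [t t' | | ?|?|?] //=;
    rewrite ?eqxx // => wn.
  by split=> //; left; constructor.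
Qed.

Lemma step_ge0 h x y : x \in X -> 0 <= step G piR piV h x y.
Proof.
move=> /inX vx; rewrite /step; case e: (owner_of G x).
- by have [] := sR h vx e.
- by have [] := sV h vx e.
- by case: x vx e => // s s' mu mu' w _ _; case: y => //= *; exact: dist_ge0.
Qed.

Lemma step_out h x y : x \in X -> y \notin X -> step G piR piV h x y = 0.
Proof.
move=> /inX vx; apply: contraNeq => /(step_edge vx) xy.
exact/inX/(edge_vertex vx xy).
Qed.

Lemma step_sum h x : x \in X -> \sum_(y <- X) step G piR piV h x y = 1.
Proof.
move=> xX; have vx := (inX x).1 xX.
have [e|ne] := pselect (owner_of G x = Probabilistic); last first.
  have <- : \sum_(y \in setT) step G piR piV h x y = 1.
    rewrite /step; case e: (owner_of G x).
    - by have [] := sR h vx e.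
    - by have [] := sV h vx e.
    - by case: ne.
  rewrite fsbig_seq ?fset_uniq //; apply: fsbig_widen => // y [_ /=] /negP.
  exact: step_out.
case: x vx e {xX} => // s s' mu mu' w _ _.
(* Writing the weights as a sum of point masses and exchanging the sums leaves the total mass of
   [w]. *)
have st y : step G piR piV h (GP s s' mu mu' w) y =
    \sum_p (if y == GR p.1 p.2 then w p else 0).
  case: y => [t t' | | ? ? ? ?|? ? ? ?|? ? ? ? ?]; rewrite /step /=;
    try by rewrite big1 // => p _; case: eqP.
  rewrite (bigD1 (t, t')) //= eqxx big1 ?addr0 // => -[u u'] ne.
  by case: eqP => // -[e1 e2]; rewrite e1 e2 eqxx in ne.
under eq_bigr do rewrite st.
rewrite exchange_big /= -(dist_sum1 w); apply: eq_bigr => p _.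
have pX : GR p.1 p.2 \in X by apply/inX.
rewrite (bigD1_seq _ pX) ?fset_uniq //= eqxx big1 ?addr0 // => y.
by case: eqP.
Qed.

End Kernel.

Lemma snippet_fset : exists X : {fset gvertex A A'}, vertex_set G = [set` X].
Proof. exact/finite_fsetP/finite_snippet. Qed.

(** The snippet is finite, so fairness is a finite intersection of events about infinite visits. *)
Lemma measurable_fair : measurable (refuter_fair_plays G).
Proof.
have fin := finite_snippet.
rewrite (_ : refuter_fair_plays G = \bigcap_(v in vertex_set G)
  \bigcap_(u in vertex_set G) [set rho | owner_of G v = Refuter -> edge G v u ->
     visited_io rho v -> visited_io rho u]).
  apply: fin_bigcap_measurable => // v _; apply: fin_bigcap_measurable => // u _.
  have [po|po] := pselect (owner_of G v = Refuter /\ edge G v u).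
    rewrite (_ : mkset _ = ~` [set rho | visited_io rho v] `|`
                            [set rho | visited_io rho u]).
      apply: measurableU; first apply: measurableC; exact: measurable_visited_io.
    case: po => o1 o2; apply/seteqP; split=> rho /=.
      by move=> h; have [/(h o1 o2)|] := pselect (visited_io rho v); [right|left].
    by move=> [].
  rewrite (_ : mkset _ = setT) //.
  by apply/seteqP; split=> // rho _ /= o1 o2; case: po.
apply/seteqP; split=> rho /= h.
  by move=> v vv u _ o vu io; exact: (h v).
by move=> v vv o io u vu; apply: (h v vv u (edge_vertex vv vu)).
Qed.

End Snippet.

(** * The attractor condition is sufficient *)

Section Visits.
Variable V : pointedType.
Implicit Types rho : nat -> V.

Lemma io_pigeonhole (Q : nat -> Prop) (f : nat -> V) (X : {fset V}) :
  (forall n, exists2 m, (n <= m)%N & Q m) -> (forall n, f n \in X) ->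
  exists x, forall n, exists2 m, (n <= m)%N & Q m /\ f m = x.
Proof.
move=> Qio fX; apply: contrapT => /forallNP nio.
have [N HN] : exists N : V -> nat, forall x m, (N x <= m)%N -> Q m -> f m <> x.
  have {}nio x : exists n, forall m, (n <= m)%N -> Q m -> f m <> x.
    have /existsNP[n nex] := nio x; exists n => m nm Qm e.
    by apply: nex; exists m.
  by have [N HN] := choice nio; exists N.
have [m lem Qm] := Qio (\max_(x <- X) N x)%N.
apply: (HN (f m) m) => //; apply: leq_trans lem.
by rewrite (big_rem _ (fX m)) /= leq_maxl.
Qed.

Lemma count_visit_next rho v N : visited_io rho v -> exists n,
  [/\ (N <= n)%N, rho n = v & count_mem v (mkseq rho n) = count_mem v (mkseq rho N)].
Proof.
move=> io; have [m Nm rm] := io N.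
have [d] := ubnP (m - N)%N; elim: d N Nm => // d IH N Nm dlt.
have [rN|rN] := pselect (rho N = v); first by exists N.
have NM : (N < m)%N.
  by rewrite ltn_neqAle Nm andbT; apply/eqP => e; apply: rN; rewrite e.
have [|n [Nn rn cn]] := IH N.+1 NM.
  by rewrite subnS; move: dlt; case: (m - N)%N (subn_gt0 N m) => [|j]; rewrite ?NM.
exists n; split=> //; first exact: ltnW.
rewrite cn mkseqS -cats1 count_cat /= addn0.
by case: eqP => // _; rewrite addn0.
Qed.

(** The count rises by exactly one at each visit, so no later value is skipped. *)
Lemma count_visit rho v N q : visited_io rho v ->
  (count_mem v (mkseq rho N) <= q)%N ->
  exists n, [/\ (N <= n)%N, rho n = v & count_mem v (mkseq rho n) = q].
Proof.
move=> io; elim: q => [|q IH] le.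
  have [n [Nn rn cn]] := count_visit_next N io; exists n; split=> //.
  by rewrite cn; apply/eqP; rewrite -leqn0.
move: le; rewrite leq_eqVlt => /predU1P[<-|/IH[m [Nm rm cm]]].
  exact: count_visit_next.
have [n [mn rn cn]] := count_visit_next m.+1 io; exists n; split=> //.
  exact: leq_trans Nm (ltnW mn).
by rewrite cn mkseqS -cats1 count_cat cm /= rm eqxx addn0 addn1.
Qed.

Lemma round_robin_io rho (v u : V) (succ : seq V) k : visited_io rho v ->
  (forall n, (k <= n)%N -> rho n = v ->
     rho n.+1 = nth point succ (count_mem v (mkseq rho n) %% size succ)%N) ->
  u \in succ -> visited_io rho u.
Proof.
move=> io nxt us N.
have jlt : (index u succ < size succ)%N by rewrite index_mem.
pose N' := maxn N k; pose c := count_mem v (mkseq rho N').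
(* The visit number is the index of [u] modulo the period, and it is at least [c], which places the
   visit after [N']. *)
have [|n [Nn rn cn]] := @count_visit rho v N' (c * size succ + index u succ)%N io.
  rewrite -/c; apply: leq_trans (leq_addr _ _); apply: leq_pmulr.
  exact: leq_ltn_trans jlt.
exists n.+1; first by rewrite ltnW // ltnS (leq_trans (leq_maxl N k)).
rewrite nxt ?cn //; last exact: leq_trans (leq_maxr N k) Nn.
by rewrite modnMDl modn_small // nth_index.
Qed.

End Visits.

Section Sufficiency.
Variables (R : realType) (Sigma F : finType).
Variables (A : pts R Sigma) (A' : pts R (Sigma + F)%type).
Local Notation G := (vertex_snippet A A').
Local Notation err := (GErr A A').
Local Notation lose := (allPre_star [set SErr A A']).

Lemma closed_lose : allPre lose `<=` lose.
Proof. by apply: least_closed_closed => Y Y'; exact: allPre_mono. Qed.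

Lemma lose_err : lose (SErr A A').
Proof. exact: least_closed_base. Qed.

(* The vertices that force a visit to [err] once they are visited infinitely
   often contain [err] and are closed under [allPre]. *)
Lemma io_lose_err (rho : nat -> gvertex A A') g :
  (forall n, vertex_set G (rho n) /\ edge G (rho n) (rho n.+1)) ->
  refuter_fair_plays G rho ->
  (forall s s' mu mu' (w : dist R (state A * state A')%type) t t',
     w (t, t') != 0 -> visited_io rho (GP s s' mu mu' w) ->
     visited_io rho (GR t t')) ->
  lose (proj g) -> visited_io rho g -> visited_io rho err.
Proof.
move=> steps fair transfer lg; have [X eX] := snippet_fset A A'.
pose Y := [set v | forall g, proj g = v -> visited_io rho g -> visited_io rho err].
suff: lose `<=` Y by move=> /(_ _ lg) /(_ _ erefl).
apply: least_closed_ind; first by move=> _ -> [] // *.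
move=> v [vv pv] {lg}g eg io; subst v.
have vg : vertex_set G g.
  by have [n _ <-] := io 0%N; case: (steps n).
move: pv; rewrite proj_owner; case og: (masking_owner g).
- move=> [u [gu Yu]]; have vu := sg_edge_vertex vv gu.
  have [g' eg' vg'] := lift_vertex vu; apply: (Yu g') => //.
  apply: (fair g) => //; apply: lift_edge => //; last by rewrite eg'.
  by rewrite /= og.
- move=> sub.
  have [||g' g'io] := @io_pigeonhole _ (fun n => rho n = g) (rho \o succn) X.
  + exact: io.
  + by move=> n /=; have [+ _] := steps n.+1; rewrite eX.
  have gg' : edge G g g'.
    by have [n _ [<- <-]] := g'io 0%N; case: (steps n).
  apply: (sub (proj g')) => //; first exact: proj_edge.
  move=> n; have [m nm [_ e]] := g'io n; exists m.+1 => //.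
  exact: leqW.
- case: g vg og io {vv} => // s s' mu mu' w [/= [_ cw] _] _ io.
  move=> [_ [_ [_ [_ [[_ _ <- <-] nsol]]]]].
  (* Otherwise [w] itself would solve [Eq], having no weight on [Y]. *)
  have [t [t' [wn Ytt]]] : exists t t', w (t, t') != 0 /\ Y (SR t t').
    apply: contrapT => nex; apply: nsol; exists (fun t t' => w (t, t')).
    have out t t' : w (t, t') != 0 -> (t \in supp mu) && (t' \in supp mu').
      exact: coupling_supp.
    have [c1 c2] := cw; split.
    + move=> t _; rewrite -c1 big_mkcond; apply: eq_bigr => t' _.
      by case: ifPn => // nt; apply/eqP; rewrite eq_sym; apply: contraNT nt => /out/andP[].
    + move=> t' _; rewrite -c2 big_mkcond; apply: eq_bigr => t _.
      by case: ifPn => // nt; apply/eqP; rewrite eq_sym; apply: contraNT nt => /out/andP[].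
    + by move=> *; exact: dist_ge0.
    + rewrite big1 // => t _; rewrite big1 // => t' /andP[_ /asboolP Ytt].
      by apply/eqP/negPn/negP => wn; apply: nex; exists t, t'.
  by apply: (Ytt (GR t t')) => //; exact: transfer wn io.
Qed.

Lemma failing_sufficient : ~ exPre_star (sg_vertices A A' `\` lose) (sg_initial A A') ->
  almost_sure_failing_under_fairness G err.
Proof.
move=> ninit piV sV piR [sR fR] P PP.
have [X eX] := snippet_fset A A'.
have inX g : (g \in X) <-> vertex_set G g by rewrite eX.
have fair := (ae_prob1 P (@measurable_fair _ _ _ A A')).2 (fR _ sV _ PP).
have initX : initial G \in X by apply/inX.
have ge0 := step_ge0 sR sV eX; have sum1 := step_sum sR sV eX.
have steps := ae_steps initX ge0 sum1 PP.
(* The weights [delta] do not depend on the history, which supplies the uniform lower bound for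
   [ae_transfer]. *)
have transfer : \forall rho \ae P, forall vu : X * X,
    owner_of G (val vu.1) = Probabilistic ->
    delta G (val vu.1) (val vu.2) != 0 ->
    visited_io rho (val vu.1) -> visited_io rho (val vu.2).
  apply: ae_forall_countType => -[v u] /=.
  have [[ov dn]|nvu] := pselect (owner_of G (val v) = Probabilistic /\
      delta G (val v) (val u) != 0); last first.
    by apply: aeW => rho ov dn; case: nvu.
  have stE h y : step G piR piV h (val v) y = delta G (val v) y.
    by rewrite /step ov.
  have d0 : 0 < delta G (val v) (val u).
    by rewrite lt_def dn -(stE [::]) /=; apply: ge0; exact: fsvalP.
  have H : \forall rho \ae P, visited_io rho (val v) -> visited_io rho (val u).
    apply: (ae_transfer initX ge0 sum1 PP (fsvalP v) (fsvalP u) d0) => h.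
    by rewrite stE.
  have aeF := ae_filter_ringOfSetsType P.
  by apply: filterS H => rho H _ _.
apply/ae_prob1.
  rewrite (_ : mkset _ = \bigcup_n [set rho : plays _ | rho n = err]).
    by apply: bigcupT_measurable => n; exact: measurable_coord.
  by apply/seteqP; split=> rho [n] *; exists n.
have aeF := ae_filter_ringOfSetsType P.
apply: filterS3 fair steps transfer => rho fair [r0 steps] transfer.
have {}steps n : vertex_set G (rho n) /\ edge G (rho n) (rho n.+1).
  have [/inX vn sn] := steps n; split=> //; exact: step_edge sn.
(* The complement of [exPre_star] is closed under edges, so the play stays in it, and each of its
   vertices lies in the attractor. *)
have loseP n : lose (proj (rho n)).
  suff nZ : ~ exPre_star (sg_vertices A A' `\` lose) (proj (rho n)).
    apply: contrapT => nl; apply: nZ; apply: least_closed_base; split=> //.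
    by apply: proj_vertex; case: (steps n).
  elim: n => [|n IH]; first by rewrite r0.
  move=> Z; apply: IH; apply: (least_closed_closed (@exPre_mono _ _ _ A A')).
  have [vn en] := steps n; split; first exact: proj_vertex.
  by exists (proj (rho n.+1)); split=> //; exact: proj_edge.
have [||g gio] := @io_pigeonhole _ xpredT rho X.
- by move=> n; exists n.
- by move=> n; apply/inX; case: (steps n).
have {}gio : visited_io rho g by move=> n; have [m ? []] := gio n; exists m.
have lg : lose (proj g) by have [n _ <-] := gio 0%N.
have [] := io_lose_err steps fair _ lg gio 0%N; last by move=> n; exists n.
move=> s s' mu mu' w t t' wn io.
have [n _ rn] := io 0%N; have [vn _] := steps n.
have vX : GP s s' mu mu' w \in X by rewrite -rn; apply/inX.
have uX : GR t t' \in X by apply/inX.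
exact: (transfer ([` vX]%fset, [` uX]%fset)).
Qed.

End Sufficiency.

(** * The attractor condition is necessary *)

Section Necessity.
Variables (R : realType) (Sigma F : finType).
Variables (A : pts R Sigma) (A' : pts R (Sigma + F)%type).
Local Notation V := (gvertex A A').
Local Notation G := (vertex_snippet A A').
Local Notation err := (GErr A A').
Local Notation lose := (allPre_star [set SErr A A']).

(** The attractor only records whether some coupling avoids it; a concrete probabilistic vertex must
    avoid it with its own coupling. *)
Definition safe : set V := [set g | [/\ vertex_set G g, ~ lose (proj g) &
  if g is GP s s' mu mu' w then forall t t', w (t, t') != 0 -> ~ lose (SR t t')
  else True]].

(** At a probabilistic vertex outside the attractor [Eq] has a solution, and an extreme coupling
    supported within it avoids the attractor too. *)
Lemma safe_lift v : sg_vertices A A' v -> ~ lose v -> exists2 g, proj g = v & safe g.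
Proof.
move=> vv nl; have [g eg vg] := lift_vertex vv.
case: g eg vg => [s s' | | s a s' mu|s a s' mu'|s s' mu mu' w] /= eg vg; subst v.
- by exists (GR s s').
- by exists err.
- by exists (GV1 s a s' mu).
- by exists (GV2 s a s' mu').
have [x sol] : exists x, Eq_solution mu mu' lose x.
  apply: contrapT => ns; apply: nl; apply: closed_lose; split=> //=.
  by exists s, s', mu, mu'.
have [w1 c1 w1P] := Eq_solution_coupling sol.
have [p w1p] := dist_inhabited w1.
have [w2 [e2 _ sub]] := extreme_coupling_below c1 w1p.
exists (GP s s' mu mu' w2) => //; split=> //.
  by split=> //; split=> //; case: e2.
move=> t t' w2n; apply: w1P; apply: contraNneq w2n => w10.
by apply/eqP/sub.
Qed.

Lemma safe_err : ~ safe err.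
Proof. by move=> [_ + _]; apply; exact: lose_err. Qed.

Lemma safe_refuter g g' : safe g -> owner_of G g = Refuter -> edge G g g' -> safe g'.
Proof.
move=> [vg nl _] og gg'; have gg := proj_edge vg gg'; split.
- exact: edge_vertex gg'.
- move=> l; apply: nl; apply: closed_lose; split; first exact: proj_vertex.
  by rewrite proj_owner [masking_owner g]og; exists (proj g').
- by case: g og gg' {vg nl gg} => // [s s'|] _ [_ _ [mv|[]//]]; inversion mv.
Qed.

Lemma safe_verifier g : safe g -> owner_of G g = Verifier ->
  exists g', edge G g g' /\ safe g'.
Proof.
move=> [vg nl _] og; have pv := proj_vertex vg.
have [u gu nlu] : exists2 u, sg_edge (proj g) u & ~ lose u.
  apply: contrapT => nex; apply: nl; apply: closed_lose; split=> //.
  by rewrite proj_owner [masking_owner g]og => u gu; apply: contrapT => nlu; apply: nex; exists u.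
have [g' eg' sg'] := safe_lift (sg_edge_vertex pv gu) nlu.
exists g'; split=> //; apply: lift_edge => //; [by case: sg'|by rewrite og|].
by rewrite eg'.
Qed.

Lemma safe_prob g g' : safe g -> owner_of G g = Probabilistic -> edge G g g' -> safe g'.
Proof.
case: g => // s s' mu mu' w [_ _ ws] _ [_ _ [mv|[]//]].
by inversion mv; subst; split=> //; exact: ws.
Qed.

Definition reaches_safe (g : V) := exists (p : nat -> V) (k : nat),
  [/\ p 0%N = g, forall i, (i < k)%N -> vertex_set G (p i) /\ edge G (p i) (p i.+1)
    & safe (p k)].

Lemma reaches_safe_step g g' : vertex_set G g -> edge G g g' ->
  reaches_safe g' -> reaches_safe g.
Proof.
move=> vg gg' [p [k [p0 ep sp]]].
exists (fun i => if i is j.+1 then p j else g), k.+1; split=> //.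
by move=> [|i] ik; [rewrite p0|exact: ep].
Qed.

(** The lift is built backwards from the safe end, since the coupling at a probabilistic vertex must
    be chosen to charge the next vertex of the path. *)
Lemma exPre_star_reaches v : exPre_star (sg_vertices A A' `\` lose) v ->
  exists2 g, proj g = v & vertex_set G g /\ reaches_safe g.
Proof.
pose Y := [set v | exists2 g, proj g = v & vertex_set G g /\ reaches_safe g].
suff sub : exPre_star (sg_vertices A A' `\` lose) `<=` Y by move=> /sub.
apply: least_closed_ind => {}v.
  move=> [vv nl]; have [g eg sg] := safe_lift vv nl; exists g => //.
  by split; [case: sg|exists (fun=> g), 0%N; split].
move=> [vv [u [vu [g' eg' [vg' rg']]]]]; have [g eg vg] := lift_vertex vv.
have [og|og] := pselect (owner_of G g = Probabilistic); last first.
  exists g => //; split=> //; apply: reaches_safe_step rg' => //.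
  by apply: lift_edge => //; rewrite eg eg'.
case: g eg vg og => // s s' mu mu' _ /= ev [[/= ma _] _] _; subst v u.
case: g' vg' rg' vu => [t t' | | t b t' nu|t b t' nu'|t t' nu nu' w'] vg' rg' [mv|[]//];
  inversion mv; subst.
(* The product coupling charges [(t, t')], and an extreme coupling below it can keep that entry
   positive. *)
have [w0 [c0 w0E]] := product_coupling mu mu'.
have [tm tm'] : t \in supp mu /\ t' \in supp mu' by [].
have w0n : w0 (t, t') != 0 by rewrite !inE in tm tm'; rewrite w0E mulf_neq0.
have [w [ew wn _]] := extreme_coupling_below c0 w0n.
have vw : vertex_set G (GP s s' mu mu' w).
  by split=> //; split=> //; case: ew.
exists (GP s s' mu mu' w) => //; split=> //; apply: reaches_safe_step rg' => //.
by split=> //; left; constructor.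
Qed.

Definition det (next : seq V -> V -> V) : strategy R V :=
  fun h v u => (u == next h v)%:R.

Lemma det_strategy o next :
  (forall h v, vertex_set G v -> owner_of G v = o -> edge G v (next h v)) ->
  is_strategy G o (det next).
Proof.
move=> ok h v vv ov; split=> [u|u|]; first by rewrite ler0n.
  by rewrite /det; case: (u =P next h v) => [-> _|]; [exact: ok|rewrite eqxx].
rewrite -(@fsbig_widen _ _ _ _ [set next h v]) //; last first.
  by move=> u [_ /= ne]; rewrite /det; case: (u =P next h v).
by rewrite fsbig_set1 /det eqxx.
Qed.

(** * A pair of strategies that follows a path to a safe vertex *)

Section Path.
Variables (p : nat -> V) (k : nat).
Hypothesis p0 : p 0%N = initial G.
Hypothesis pedge : forall i, (i < k)%N -> vertex_set G (p i) /\ edge G (p i) (p i.+1).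
Hypothesis psafe : safe (p k).

(** The time is [size h]; the test on [v] keeps the choice legal for plays that have left the
    path. *)
Definition along (other : seq V -> V -> V) (h : seq V) (v : V) : V :=
  if (size h < k)%N && (v == p (size h)) then p (size h).+1 else other h v.

Definition succs (v : V) : seq V := fset_set [set u | edge G v u].

Definition round_robin (h : seq V) (v : V) : V :=
  nth point (succs v) (count_mem v h %% size (succs v))%N.

(** The fallback to an arbitrary successor keeps the strategy legal where no successor is safe. *)
Definition stay_safe (h : seq V) (v : V) : V :=
  xget (xget point [set u | edge G v u]) [set u | edge G v u /\ safe u].

Lemma mem_succs v u : vertex_set G v -> (u \in succs v) <-> edge G v u.
Proof.
move=> vv; rewrite /succs in_fset_set; last first.
  by apply: sub_finite_set (finite_snippet A A') => w; exact: edge_vertex.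
by split=> [/set_mem|h]; last exact/mem_set.
Qed.

Lemma along_edge other h v :
  (vertex_set G v -> edge G v (other h v)) -> vertex_set G v -> edge G v (along other h v).
Proof.
move=> ok vv; rewrite /along; case: ifP => [/andP[lt /eqP ->]|_]; last exact: ok.
by have [] := pedge lt.
Qed.

Lemma round_robin_strategy : is_strategy G Refuter (det (along round_robin)).
Proof.
apply: det_strategy => h v vv ov; apply: along_edge => // _.
have [|u vu] := edge_exists vv; first by rewrite ov.
have us := (mem_succs u vv).2 vu.
apply/mem_succs => //; apply: mem_nth; rewrite ltn_mod.
by case: (succs v) us.
Qed.

Lemma stay_safe_strategy : is_strategy G Verifier (det (along stay_safe)).
Proof.
apply: det_strategy => h v vv ov; apply: along_edge => // _.
have [|u vu] := edge_exists vv; first by rewrite ov.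
rewrite /stay_safe; case: xgetP => [w -> [] //|_].
exact: (@xgetPex _ point [set u | edge G v u] (ex_intro _ u vu)).
Qed.

Lemma det_neq0 next h v u : det next h v u != 0 -> u = next h v.
Proof. by rewrite /det; case: (u =P next h v) => //; rewrite eqxx. Qed.

(** From time [k] on, every play that obeys the kernel takes the successors of each Refuter vertex
    in cyclic order, whatever the Verifier does. *)
Lemma round_robin_fair : fair_refuter_strategy G (det (along round_robin)).
Proof.
split; first exact: round_robin_strategy.
move=> piV sV P PP; apply/ae_prob1; first exact: measurable_fair.
have sR := round_robin_strategy.
have [X eX] := snippet_fset A A'.
have initX : initial G \in X by have : vertex_set G (initial G) by []; rewrite eX.
have steps := ae_steps initX (step_ge0 sR sV eX) (step_sum sR sV eX) PP.
have aeF := ae_filter_ringOfSetsType P.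
apply: filterS steps => rho [_ steps] v vv ov io u vu.
apply: (@round_robin_io _ rho v u (succs v) k io); last exact/mem_succs.
move=> n kn rn; have [_] := steps n; rewrite /step rn ov => /det_neq0 ->.
by rewrite /along size_mkseq ltnNge kn.
Qed.

(** The plays that follow [p] up to time [k] have positive probability. Almost all of them stay safe
    afterwards, and the error vertex is absorbing and unsafe, so they never reach it. *)
Lemma path_not_failing : ~ almost_sure_failing_under_fairness G err.
Proof.
move=> fail.
pose piR := det (along round_robin); pose piV := det (along stay_safe).
have sR : is_strategy G Refuter piR := round_robin_strategy.
have sV : is_strategy G Verifier piV := stay_safe_strategy.
have [X eX] := snippet_fset A A'.
have initX : initial G \in X by have : vertex_set G (initial G) by []; rewrite eX.
have ge0 := step_ge0 sR sV eX; have sum1 := step_sum sR sV eX.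
have [P PP] := process_exists initX ge0 sum1 (step_out sR sV eX).
have steps := ae_steps initX ge0 sum1 PP.
have PE := fail piV sV piR round_robin_fair P PP.
have mE : measurable [set rho : plays V | exists n, rho n = err].
  rewrite (_ : mkset _ = \bigcup_n [set rho : plays V | rho n = err]).
    by apply: bigcupT_measurable => n; exact: measurable_coord.
  by apply/seteqP; split=> rho [n] *; exists n.
have aeE := (ae_prob1 P mE).2 PE.
have aeF := ae_filter_ringOfSetsType P.
pose C := [set rho : plays V | forall i, (i <= k)%N -> rho i = p i].
have mC : measurable C.
  rewrite (_ : C = \bigcap_(i in [set i | (i <= k)%N]) [set rho : plays V | rho i = p i]).
    by apply: bigcap_measurableType => i _; exact: measurable_coord.
  by apply/seteqP; split=> rho h i ik; exact: h.
have PC : P C = 0%E.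
  have : \forall rho \ae P, (~` C) rho.
    apply: filterS2 aeE steps => rho [n rn] [r0 steps] Crho.
    have {}steps m : vertex_set G (rho m) /\ step G piR piV (mkseq rho m) (rho m) (rho m.+1) != 0.
      by have [mX sm] := steps m; split=> //; rewrite eX.
    have edges m : edge G (rho m) (rho m.+1).
      by have [vm sm] := steps m; exact: step_edge sm.
    have stay m : (k <= m)%N -> safe (rho m).
      elim: m => [|m IH]; first by rewrite leqn0 => /eqP k0; rewrite Crho // -k0.
      rewrite leq_eqVlt => /predU1P[<-|]; first by rewrite Crho.
      rewrite ltnS => km; have sm := IH km; have [_] := steps m.
      rewrite /step; case om: (owner_of G (rho m)).
      - by move=> _; exact: safe_refuter (edges m).
      - move=> /det_neq0 ->; rewrite /along size_mkseq ltnNge km /= /stay_safe.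
        have [g' ge'] := safe_verifier sm om.
        by have [] := @xgetPex _ (xget point [set u | edge G (rho m) u])
          [set u | edge G (rho m) u /\ safe u] (ex_intro _ g' ge').
      - by move=> _; exact: safe_prob (edges m).
    have errs m : (n <= m)%N -> rho m = err.
      elim: m => [|m IH]; first by rewrite leqn0 => /eqP n0; rewrite -n0.
      rewrite leq_eqVlt => /predU1P[<- //|/IH rm].
      by have := edges m; rewrite rm => -[_ _ [mv|[]//]]; inversion mv.
    apply: safe_err; rewrite -(errs (maxn n k) (leq_maxl _ _)).
    exact: stay (leq_maxr _ _).
  move=> /(ae_prob1 P (measurableC mC)).1 e.
  by have := probability_setC P (measurableC mC); rewrite setCK e subee.
(* Each factor of the path probability is nonzero: 1 for the deterministic moves of the players, and
   a nonzero entry of the coupling on a probabilistic edge. *)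
have := PP p k; rewrite -/C PC p0 eqxx mul1r => -[] /esym/eqP.
apply/negP; rewrite prodf_seq_neq0; apply/allP => i _ /=.
have [vi ei] := pedge (ltn_ord i).
have al other : along other (mkseq p i) (p i) = p i.+1.
  by rewrite /along size_mkseq ltn_ord eqxx.
rewrite /step; case oi: (owner_of G (p i)).
- by rewrite /piR /det al eqxx oner_eq0.
- by rewrite /piV /det al eqxx oner_eq0.
- case: (p i) oi ei => // s s' mu mu' w _ [_ _ [mv|[]//]].
  by inversion mv.
Qed.

End Path.

Lemma failing_necessary : almost_sure_failing_under_fairness G err ->
  ~ exPre_star (sg_vertices A A' `\` lose) (sg_initial A A').
Proof.
move=> fail /exPre_star_reaches[[s s' | | | | ] //= [e1 e2] [_ [p [k [p0 pe ps]]]]].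
by apply: path_not_failing pe ps fail; rewrite p0 e1 e2.
Qed.

End Necessity.

Theorem theorem5 (R : realType) (Sigma F : finType)
    (A : pts R Sigma) (A' : pts R (Sigma + F)%type) :
  almost_sure_failing_under_fairness (vertex_snippet A A') (GErr A A') <->
  (sg_vertices A A' `\`
     exPre_star (sg_vertices A A' `\` allPre_star [set SErr A A']))
    (sg_initial A A').
Proof.
split=> [fail|[_ ninit]]; last exact: failing_sufficient.
by split=> //; exact: failing_necessary.
Qed.
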